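(* Let $X$ be a quasi-affine variety of dimension $n\ge 2$ over $\Bbbk$ equipped with an open embedding $X\hookrightarrow\operatorname{Spec}\Lambda$ into an affine $\Bbbk$-scheme, where $\Lambda\subseteq\mathcal{O}_X(X)$. Let $G=\langle\mathcal{N}\rangle\subseteq\operatorname{SAut}(X)$ be the subgroup generated by a $\Lambda$-saturated set $\mathcal{N}\subseteq\operatorname{LND}_\Lambda(X)$ of (nonzero) locally nilpotent derivations. Suppose that $G$ acts transitively on $X$. Then for any locally nilpotent derivation $\delta_0\in\mathcal{N}$ one can find another one $\delta_1\in\mathcal{N}$ such that the subgroup $$H=\langle\langle\delta_0,\delta_1\rangle\rangle$$ generated by $\delta_0$, $\delta_1$ and all their $\Lambda$-replicas acts with an open orbit on $X$.
   Context: $\Bbbk$ is an algebraically closed field of characteristic $0$. $\operatorname{SAut}(X)\subseteq\operatorname{Aut}(X)$ is the subgroup generated by all one-parameter unipotent subgroups (images of algebraic $\mathbb{G}_a$-actions). Let $A=\mathcal{O}_X(X)$ and let $\Lambda\subseteq A$ be a $\Bbbk$-subalgebra (not necessarily finitely generated) such that the induced map $X\to\operatorname{Spec}\Lambda$ is an open embedding. Let $\mathfrak{b}\subseteq\Lambda$ be the ideal of $\operatorname{Spec}(\Lambda)\setminus X$. $\operatorname{LND}_\Lambda(X)$ denotes the set of locally nilpotent $\Bbbk$-derivations $\delta$ of $\Lambda$ with $\delta(\mathfrak{b})\subseteq\mathfrak{b}$; each such $\delta$ induces a one-parameter unipotent subgroup $\exp(\Bbbk\delta)$ of $\operatorname{Aut}(X)$.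 For a set $\mathcal{N}$ of nonzero elements of $\operatorname{LND}_\Lambda(X)$, $\langle\mathcal{N}\rangle$ is the subgroup generated by all $\exp(\Bbbk\delta)$, $\delta\in\mathcal{N}$. A $\Lambda$-replica of $\delta$ is a derivation $f\delta$ with $f\in\Lambda$, $f\in\ker\delta$. $\mathcal{N}$ is $\Lambda$-saturated if it is closed under conjugation by elements of $G=\langle\mathcal{N}\rangle$ and $f\delta\in\mathcal{N}$ for all $\delta\in\mathcal{N}$ and all nonzero $f\in\ker_\Lambda\delta$. $\langle\langle\delta_0,\delta_1\rangle\rangle$ denotes the subgroup of $\operatorname{Aut}(X)$ generated by all $\exp(\Bbbk f_0\delta_0)$ and $\exp(\Bbbk f_1\delta_1)$ with $f_i\in\ker_\Lambda\delta_i$. *)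

(* Defs.v *)
From mathcomp Require Import all_boot all_order all_algebra.
From mathcomp Require Import mpoly.
From mathcomp Require Import boolp classical_sets.

Set Implicit Arguments.
Unset Strict Implicit.
Unset Printing Implicit Defensive.

Import GRing.Theory.
Local Open Scope classical_set_scope.
Local Open Scope ring_scope.

(** * Quasi-affine varieties: locally closed irreducible subsets [X] of k^m,
    with [X] also used as the type of its (closed) points. *)

Definition affine_space (k : Type) (m : nat) : Type := 'I_m -> k.

Section Variety.
Context (k : fieldType) (m : nat).

Definition zero_locus (S : set {mpoly k[m]}) : set (affine_space k m) :=
  [set x | forall p, S p -> p.@[x] = 0].

Definition locally_closed (X : set (affine_space k m)) : Prop :=
  exists S T : set {mpoly k[m]}, X = zero_locus S `\` zero_locus T.

Context (X : set (affine_space k m)).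

Definition zclosed (Z : set X) : Prop :=
  exists S : set {mpoly k[m]}, Z = [set x : X | zero_locus S (\val x)].

Definition zopen (U : set X) : Prop := zclosed (~` U).

Definition irreducible (Z : set X) : Prop :=
  Z !=set0 /\
  forall Z1 Z2 : set X, zclosed Z1 -> zclosed Z2 ->
    Z `<=` Z1 `|` Z2 -> Z `<=` Z1 \/ Z `<=` Z2.

Definition quasi_affine_variety : Prop :=
  locally_closed X /\ irreducible [set: X].

(** The points of the scheme attached to [X] are the irreducible closed subsets
    of [X]; the open set attached to a Zariski open [U] consists of those that
    meet [U]. *)
Definition scheme_point (Z : set X) : Prop := zclosed Z /\ irreducible Z.

Definition has_chain (n : nat) : Prop :=
  exists Z : nat -> set X,
    (forall i, (i <= n)%N -> scheme_point (Z i)) /\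
    (forall i, (i < n)%N -> Z i `<` Z i.+1).

Definition has_dim (n : nat) : Prop := has_chain n /\ ~ has_chain n.+1.

(** A regular function on an open [U] is represented by a total function on [X]
    whose values outside [U] are irrelevant. *)
Definition regular_on (U : set X) (f : X -> k) : Prop :=
  forall x, U x -> exists (p q : {mpoly k[m]}) (V : set X),
    [/\ zopen V, V x, V `<=` U &
        forall y, V y -> q.@[\val y] != 0 /\ f y = p.@[\val y] / q.@[\val y]].

Definition morphism (g : X -> X) : Prop :=
  forall U : set X, zopen U ->
    zopen (g @^-1` U) /\
    (forall f : X -> k, regular_on U f -> regular_on (g @^-1` U) (f \o g)).

Definition automorphism (g : X -> X) : Prop :=
  exists h : X -> X, [/\ cancel g h, cancel h g, morphism g & morphism h].

Inductive generated (S : set (X -> X)) : (X -> X) -> Prop :=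
| generated_in g : S g -> generated S g
| generated_id : generated S id
| generated_comp g h : generated S g -> generated S h -> generated S (g \o h)
| generated_inv g h :
    generated S g -> cancel g h -> cancel h g -> generated S h.

Definition transitive_on (G : set (X -> X)) : Prop :=
  forall x y : X, exists2 g, G g & g x = y.

Definition orbit_of (G : set (X -> X)) (x : X) : set X :=
  [set y | exists2 g, G g & g x = y].

Definition acts_with_open_orbit (G : set (X -> X)) : Prop :=
  exists x : X, zopen (orbit_of G x).

End Variety.

Section Spec.
Context (L : comNzRingType).

Definition prime_ideal (p : set L) : Prop :=
  [/\ p 0 /\ ~ p 1,
      forall a b, p a -> p b -> p (a + b),
      forall a b, p b -> p (a * b) &
      forall a b, p (a * b) -> p a \/ p b].

Definition spec_open (V : set (set L)) : Prop :=
  exists S : set L, V = [set p | prime_ideal p /\ ~ (S `<=` p)].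

End Spec.

Section Embedding.
Context (k : fieldType) (m : nat) (X : set (affine_space k m)).
Context (L : comAlgType k).
(** [L] is viewed as an algebra of functions on [X] by evaluation:
    [ev x a] is the value of [a] at [x]. *)
Context (ev : X -> {lrmorphism L -> k^o}).

Definition algebra_of_regular_functions : Prop :=
  (forall a b : L, (forall x, ev x a = ev x b) -> a = b) /\
  (forall a : L, regular_on [set: X] (fun x => ev x a)).

(** The map from the scheme [X] to Spec [L] on points *)
Definition to_spec (Z : set X) : set L := [set a | forall x, Z x -> ev x a = 0].

(** The map X -> Spec L is injective and open (its continuity being
    automatic), and induces isomorphisms from the localization of [L] at
    [to_spec Z] to the local ring of [X] at [Z]; the last two clauses are
    surjectivity and injectivity of the latter. *)
Definition open_embedding : Prop :=
  [/\ forall Z1 Z2 : set X, scheme_point Z1 -> scheme_point Z2 ->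
        to_spec Z1 = to_spec Z2 -> Z1 = Z2,
      forall U : set X, zopen U ->
        spec_open (to_spec @` [set Z | scheme_point Z /\ Z `&` U !=set0]),
      forall (Z : set X) (U : set X) (f : X -> k),
        scheme_point Z -> zopen U -> Z `&` U !=set0 -> regular_on U f ->
        exists (a s : L) (V : set X),
          [/\ ~ to_spec Z s, zopen V, V `<=` U, Z `&` V !=set0 &
              forall y, V y -> ev y s != 0 /\ f y = ev y a / ev y s] &
      forall (Z : set X) (V : set X) (a : L),
        scheme_point Z -> zopen V -> Z `&` V !=set0 ->
        (forall y, V y -> ev y a = 0) ->
        exists2 t : L, ~ to_spec Z t & t * a = 0].

(** The ideal of the complement of [X] in Spec [L] *)
Definition boundary_ideal : set L :=
  [set a | forall p, prime_ideal p ->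
             ~ (to_spec @` [set Z | scheme_point Z]) p -> p a].

Definition derivation (d : L -> L) : Prop :=
  (forall (c : k) (a b : L), d (c *: a + b) = c *: d a + d b) /\
  (forall a b : L, d (a * b) = d a * b + a * d b).

Definition LND : set (L -> L) :=
  [set d | [/\ derivation d,
               forall a, exists j, iter j d a = 0 &
               forall a, boundary_ideal a -> boundary_ideal (d a)]].

(** exp(k d), as a set of automorphisms of [X]: its elements are those
    whose comorphism restricts to exp(t d) = sum_i t^i d^i / i! on [L]. *)
Definition exp_subgroup (d : L -> L) : set (X -> X) :=
  [set g | automorphism g /\
     exists t : k, forall (a : L) (j : nat), iter j d a = 0 ->
       forall x, ev (g x) a =
         ev x (\sum_(i < j) (t ^+ i / (i`!)%:R) *: iter i d a)].

Definition group_of (N : set (L -> L)) : set (X -> X) :=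
  generated [set g | exists2 d, N d & exp_subgroup d g].

Definition replica (f : L) (d : L -> L) : L -> L := fun a => f * d a.

(** [d'] is the conjugate of [d] by [g]: d' o g^* = g^* o d, where g^* is
    composition with [g], a bijection of [L] for every [g] in [group_of N]. *)
Definition conjugate (g : X -> X) (d d' : L -> L) : Prop :=
  forall a b : L, (forall x, ev x b = ev (g x) a) ->
    forall x, ev x (d' b) = ev (g x) (d a).

Definition saturated (N : set (L -> L)) : Prop :=
  (forall (g : X -> X) (d d' : L -> L),
     group_of N g -> N d -> conjugate g d d' -> N d') /\
  (forall (d : L -> L) (f : L), N d -> d f = 0 -> f != 0 -> N (replica f d)).

Definition replica_group (d0 d1 : L -> L) : set (X -> X) :=
  group_of [set d | exists f : L, (d0 f = 0 /\ d = replica f d0) \/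
                                  (d1 f = 0 /\ d = replica f d1)].

End Embedding.

(* Main.v *)
Require Import Defs.
From mathcomp Require Import all_boot all_order all_algebra.
From mathcomp Require Import closed_field mpoly ring zify.
From mathcomp Require Import boolp classical_sets.

Set Implicit Arguments.
Unset Strict Implicit.
Unset Printing Implicit Defensive.

Import GRing.Theory.
Local Open Scope classical_set_scope.
Local Open Scope ring_scope.

(** The proof compares the vectors that derivations define at a point x of [X]:
    a derivation d has the value a |-> (d a)(x), a linear form on [L].

    Reduction to tangent vectors. Let e_0, ..., e_s be elements of [N] whose
    values at x span the values at x of all of [N]. Then a function a <> 0 in
    [L] does not vanish on all points exp(t_0 e_0) ... exp(t_s e_s) x. Indeed,
    transitivity of the group gives a word in [N] that does not kill a at x
    ([transitive_word]). In a shortest such word the letters commute, because a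
    commutator is a derivative of conjugates, which belong to [N]; so the word
    is a symmetric multilinear form in the values of its letters, and the
    letters can be replaced by e_0, ..., e_s and sorted
    ([word_in_span], [flows_injective]). The product of the flows of the e_i
    thus dominates [X], and by Chevalley's theorem its image contains a
    nonempty open set ([dominant_flows_open]). An orbit with a nonempty open
    subset is open ([open_orbit]).

    Construction of d1. It is enough to find d1 in [N] and times t_l such that
    d0 and the conjugates exp(t_l d0) d1 exp(-t_l d0) span the values of [N] at
    x, since the flows of these conjugates belong to the group of d0 and d1.
    The value at x of such a conjugate is the value of d1 at the point
    y_l = exp(t_l d0) x, transported to x. Choose a maximal independent family
    sigma_1, ..., sigma_s in [N]; it exists because tangent vectors are
    determined by their values on local coordinates ([rank_bounded]). A sigma_l whose kernel lies in ker d0 is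
    proportional to d0 and may be replaced by d0 ([adapted_frame]); any other
    sigma_l has f_l in its kernel with d0 f_l <> 0, so that f_l separates the
    points y_i on the d0-orbit of a generic x. A polynomial F_l in f_l vanishes
    at all the y_i, to second order except at y_l. Conjugation by exp(F_l sigma_l)
    fixes the y_i and adds to the value at y_l of the conjugated derivation a
    nonzero multiple of sigma_l, without changing its values at the other y_i
    ([independent_twists]). Starting from d0 and doing this for all l yields d1
    ([spanning_derivation]). *)

(** * Locally nilpotent derivations and their exponentials *)

Section Flows.
Context (k : fieldType) (char0 : [pchar k] =i pred0) (L : comAlgType k).
Implicit Types (d : L -> L) (a b f : L) (s t c : k).

Lemma natr_neq0 i : (0 < i)%N -> i%:R != 0 :> k.
Proof. by move=> i0; rewrite (pcharf0P k).1 // -lt0n. Qed.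

Lemma fact_neq0 i : (i`!)%:R != 0 :> k.
Proof. exact/natr_neq0/fact_gt0. Qed.

Section Derivation.
Context (d : L -> L) (hd : derivation d).

Lemma der0 : d 0 = 0.
Proof.
have := hd.1 1 0 0; rewrite !scale1r addr0 => h.
by apply: (@addrI _ (d 0)); rewrite -h addr0.
Qed.

Lemma derD a b : d (a + b) = d a + d b.
Proof. by have := hd.1 1 a b; rewrite !scale1r. Qed.

Lemma derZ c a : d (c *: a) = c *: d a.
Proof. by have := hd.1 c a 0; rewrite der0 !addr0. Qed.

Lemma derN a : d (- a) = - d a.
Proof. by rewrite -scaleN1r derZ scaleN1r. Qed.

Lemma derB a b : d (a - b) = d a - d b.
Proof. by rewrite derD derN. Qed.

Lemma derM a b : d (a * b) = d a * b + a * d b.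
Proof. exact: hd.2. Qed.

Lemma der1 : d 1 = 0.
Proof.
have := derM 1 1; rewrite !mul1r mulr1 => h.
by apply: (@addrI _ (d 1)); rewrite -h addr0.
Qed.

Lemma der_sum (I : Type) (r : seq I) (P : pred I) (F : I -> L) :
  d (\sum_(i <- r | P i) F i) = \sum_(i <- r | P i) d (F i).
Proof. by apply: (big_morph d derD der0). Qed.

Lemma iter_der0 i : iter i d 0 = 0.
Proof. by elim: i => //= i ->; rewrite der0. Qed.

Lemma iter_derD i a b : iter i d (a + b) = iter i d a + iter i d b.
Proof. by elim: i => //= i ->; rewrite derD. Qed.

Lemma iter_derZ i c a : iter i d (c *: a) = c *: iter i d a.
Proof. by elim: i => //= i ->; rewrite derZ. Qed.

Lemma iter_der_ge i j a : (j <= i)%N -> iter j d a = 0 -> iter i d a = 0.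
Proof. by move=> /subnK <- h; rewrite iterD h iter_der0. Qed.

Lemma ker_mul a b : d a = 0 -> d b = 0 -> d (a * b) = 0.
Proof. by move=> da db; rewrite derM da db mul0r mulr0 addr0. Qed.

Lemma ker_scalar c : d (c *: 1) = 0.
Proof. by rewrite derZ der1 scaler0. Qed.

Lemma ker_prod (I : Type) (r : seq I) (P : pred I) (F : I -> L) :
  (forall i, P i -> d (F i) = 0) -> d (\prod_(i <- r | P i) F i) = 0.
Proof.
move=> h; elim/big_rec: _ => [|i x Pi dx]; first exact: der1.
by rewrite ker_mul // h.
Qed.

Lemma iter_replica f i a :
  d f = 0 -> iter i (replica f d) a = f ^+ i * iter i d a.
Proof.
move=> df; have dX j : d (f ^+ j) = 0.
  by elim: j => [|j ih]; [exact: der1 | rewrite exprS ker_mul].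
elim: i => [|i ih]; first by rewrite expr0 mul1r.
by rewrite /= ih /replica derM dX mul0r add0r mulrA exprS.
Qed.

(** The divided powers of a derivation satisfy the Leibniz rule without
    binomial coefficients, which is what makes exp multiplicative. *)
Definition divpow i a : L := (i`!)%:R^-1 *: iter i d a.

Lemma divpow_succ i a : (i.+1)%:R *: divpow i.+1 a = d (divpow i a).
Proof.
rewrite /divpow derZ scalerA factS natrM invfM mulrA divff ?natr_neq0 //.
by rewrite mul1r.
Qed.

Lemma divpowM n a b :
  divpow n (a * b) = \sum_(i < n.+1) divpow i a * divpow (n - i) b.
Proof.
elim: n => [|n ih].
  by rewrite big_ord1 /divpow /= fact0 invr1 !scale1r.
apply: (@scalerI _ _ n.+1%:R); first exact: natr_neq0.
rewrite divpow_succ ih der_sum.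
under eq_bigr => i _ do rewrite derM -!divpow_succ.
rewrite big_split /= scaler_sumr.
have -> : \sum_(i < n.+2) n.+1%:R *: (divpow i a * divpow (n.+1 - i) b) =
  \sum_(i < n.+2) ((i : nat)%:R *: (divpow i a * divpow (n.+1 - i) b)) +
  \sum_(i < n.+2) ((n.+1 - i)%:R *: (divpow i a * divpow (n.+1 - i) b)).
  rewrite -big_split /=; apply: eq_bigr => i _.
  by rewrite -scalerDl -natrD subnKC // -ltnS.
rewrite [X in _ = X + _]big_ord_recl /= scale0r add0r; congr (_ + _).
  by apply: eq_bigr => i _; rewrite scalerAl subSS.
rewrite [X in _ = X]big_ord_recr /= subnn scale0r addr0.
apply: eq_bigr => i _; by rewrite -scalerAr subSn // -ltnS.
Qed.

End Derivation.

Definition lnil d := derivation d /\ forall a, exists j, iter j d a = 0.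

Section Exponential.
Context (d : L -> L) (hd : lnil d).
Let dd : derivation d := hd.1.

Lemma expP_ex a : exists p : {poly L}, forall i, p`_i = divpow d i a.
Proof.
have [j hj] := hd.2 a; exists (\poly_(i < j) divpow d i a) => i.
rewrite coef_poly; case: ltnP => // ji.
by rewrite /divpow (iter_der_ge dd ji hj) scaler0.
Qed.

Definition exp_poly a : {poly L} := sval (cid (expP_ex a)).

Lemma coef_exp_poly a i : (exp_poly a)`_i = divpow d i a.
Proof. exact: (svalP (cid (expP_ex a))). Qed.

End Exponential.

(** The exponential exp(t d), as the value at t of a polynomial over [L]; it is
    made total by the identity when d is not locally nilpotent. *)
Definition flow d t a : L :=
  if pselect (lnil d) is left hd then (exp_poly hd a).[t *: 1] else a.

Section FlowTheory.
Context (d : L -> L) (hd : lnil d).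
Let dd : derivation d := hd.1.

Lemma flowP : {p : L -> {poly L} | (forall a i, (p a)`_i = divpow d i a) &
  forall t a, flow d t a = (p a).[t *: 1]}.
Proof.
rewrite /flow; case: pselect => // h; exists (exp_poly h) => // a i.
exact: coef_exp_poly.
Qed.

Lemma flowE t a j : iter j d a = 0 ->
  flow d t a = \sum_(i < j) (t ^+ i / (i`!)%:R) *: iter i d a.
Proof.
move=> hj; have [p hp ->] := flowP.
have sp : (size (p a) <= j)%N.
  apply/leq_sizeP => i ji; rewrite hp /divpow (iter_der_ge dd ji hj).
  by rewrite scaler0.
rewrite (horner_coef_wide _ sp); apply: eq_bigr => i _.
by rewrite hp exprZn expr1n -scalerAr mulr1 /divpow scalerA.
Qed.

Lemma flowD t a b : flow d t (a + b) = flow d t a + flow d t b.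
Proof.
have [p hp pE] := flowP; rewrite !pE -hornerD; congr (_.[_]).
apply/polyP => i; rewrite coefD !hp /divpow iter_derD //.
by rewrite scalerDr.
Qed.

Lemma flowZ t c a : flow d t (c *: a) = c *: flow d t a.
Proof.
have [p hp pE] := flowP; rewrite !pE.
have -> : c *: (p a).[t *: 1] = (((c *: 1) : L) *: p a).[t *: 1].
  by rewrite hornerZ -scalerAl mul1r.
congr (_.[_]); apply/polyP => i; rewrite coefZ !hp /divpow iter_derZ //.
by rewrite -scalerAl mul1r !scalerA mulrC.
Qed.

Lemma flowM t a b : flow d t (a * b) = flow d t a * flow d t b.
Proof.
have [p hp pE] := flowP; rewrite !pE -hornerM; congr (_.[_]).
apply/polyP => i; rewrite coefM hp divpowM //.
by apply: eq_bigr => j _; rewrite !hp.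
Qed.

Lemma flow0 t : flow d t 0 = 0.
Proof. by have := flowZ t 0 0; rewrite !scale0r. Qed.

Lemma flowN t a : flow d t (- a) = - flow d t a.
Proof. by rewrite -scaleN1r flowZ scaleN1r. Qed.

Lemma flowB t a b : flow d t (a - b) = flow d t a - flow d t b.
Proof. by rewrite flowD flowN. Qed.

Lemma flow_sum t (I : Type) (r : seq I) (P : pred I) (F : I -> L) :
  flow d t (\sum_(i <- r | P i) F i) = \sum_(i <- r | P i) flow d t (F i).
Proof. by apply: (big_morph _ (flowD t) (flow0 t)). Qed.

Lemma flow_ker t a : d a = 0 -> flow d t a = a.
Proof.
by move=> da; rewrite (@flowE t a 1) // big_ord1 expr0 fact0 divr1 scale1r.
Qed.

Lemma flow1 t : flow d t 1 = 1.
Proof. by rewrite flow_ker // der1. Qed.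

Lemma flow_id a : flow d 0 a = a.
Proof.
have [p hp ->] := flowP; rewrite scale0r horner_coef0 hp /divpow /=.
by rewrite fact0 invr1 scale1r.
Qed.

Lemma iter_flow i t a : iter i d (flow d t a) = flow d t (iter i d a).
Proof.
elim: i => //= i ->; have [j hj] := hd.2 (iter i d a).
rewrite (@flowE t _ j) // (@flowE t _ j); last by rewrite -iterSr /= hj der0.
rewrite der_sum //; apply: eq_bigr => l _.
by rewrite derZ // -iterS iterSr.
Qed.

Lemma flow_der t a : d (flow d t a) = flow d t (d a).
Proof. exact: (iter_flow 1). Qed.

(** The group law is Taylor's formula for the polynomial t |-> exp(t d) a,
    whose divided derivatives are the divided powers of d. *)
Lemma flow_comp s t a : flow d t (flow d s a) = flow d (t + s) a.
Proof.
have [p hp pE] := flowP.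
have nderivE i : (p a)^`N(i) = p (divpow d i a).
  apply/polyP => l; rewrite coef_nderivn !hp /divpow iter_derZ // scalerA.
  rewrite -iterD addnC scalerMnl; congr (_ *: _).
  have := bin_fact (leq_addl l i); rewrite addnK => /(congr1 (fun n => n%:R : k)).
  have C0 : 'C(l + i, i)%:R != 0 :> k by rewrite natr_neq0 // bin_gt0 leq_addl.
  rewrite !natrM => <-; rewrite -mulr_natl invfM mulrA mulfV // mul1r.
  by rewrite invfM mulrC.
rewrite pE (_ : p (flow d s a) = \poly_(i < size (p a)) (p a)^`N(i).[s *: 1]).
  rewrite horner_poly [RHS]pE scalerDl addrC nderiv_taylor //; exact: mulrC.
apply/polyP => i; rewrite coef_poly nderivE -pE hp.
rewrite /divpow iter_flow -flowZ; case: ltnP => // szi.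
by rewrite -[RHS](flow0 s) -[X in flow d s X]hp nth_default.
Qed.

Lemma flowK t a : flow d (- t) (flow d t a) = a.
Proof. by rewrite flow_comp addNr flow_id. Qed.

Lemma flowNK t a : flow d t (flow d (- t) a) = a.
Proof. by rewrite flow_comp addrN flow_id. Qed.

End FlowTheory.

Lemma lnil_replica d f : lnil d -> d f = 0 -> lnil (replica f d).
Proof.
move=> [dd nd] df; split; last first.
  move=> a; have [j hj] := nd a; exists j.
  by rewrite (iter_replica dd) // hj mulr0.
split=> [c a b|a b]; rewrite /replica.
  by rewrite (derD dd) (derZ dd) mulrDr scalerAr.
by rewrite (derM dd) mulrDr mulrA [X in _ + X]mulrCA.
Qed.

Lemma flow_replica_mod2 d f t a : lnil d -> d f = 0 ->
  exists b, flow (replica f d) t a = a + f * (t *: d a) + f ^+ 2 * b.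
Proof.
move=> hd df; have [j hj] := hd.2 a.
have hj2 : iter j.+2 (replica f d) a = 0.
  by rewrite (iter_replica hd.1) // (iter_der_ge hd.1 _ hj) ?mulr0 // ltnW // ltnW.
rewrite (flowE (lnil_replica hd df) t hj2) 2!big_ord_recl addrA.
exists (\sum_(i < j) (t ^+ i.+2 / (i.+2`!)%:R) *: (f ^+ i * iter i.+2 d a)).
have -> : \sum_(i < j) (t ^+ lift ord0 (lift ord0 i) /
    ((lift ord0 (lift ord0 i))`!)%:R) *: iter (lift ord0 (lift ord0 i)) (replica f d) a
  = f ^+ 2 * \sum_(i < j) (t ^+ i.+2 / (i.+2`!)%:R) *: (f ^+ i * iter i.+2 d a).
  rewrite mulr_sumr; apply: eq_bigr => i _; rewrite !lift0 -scalerAr.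
  by rewrite (iter_replica hd.1) // mulrA -exprD.
by rewrite /= expr0 fact0 divr1 scale1r expr1 divr1 /replica scalerAr.
Qed.

Definition dconj d t (sigma : L -> L) : L -> L :=
  fun a => flow d t (sigma (flow d (- t) a)).

Section Conjugation.
Context (d sigma : L -> L) (hd : lnil d) (hs : lnil sigma).

Lemma iter_conj t i a :
  iter i (dconj d t sigma) a = flow d t (iter i sigma (flow d (- t) a)).
Proof.
elim: i => [|i ih]; first by rewrite /= (flowNK hd).
by rewrite /= ih /dconj (flowK hd).
Qed.

Lemma lnil_conj t : lnil (dconj d t sigma).
Proof.
split; last first.
  move=> a; have [j hj] := hs.2 (flow d (- t) a); exists j.
  by rewrite iter_conj hj (flow0 hd).
split=> [c a b|a b]; rewrite /dconj.
  by rewrite (flowD hd) (flowZ hd) (derD hs.1) (derZ hs.1) (flowD hd) (flowZ hd).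
by rewrite (flowM hd) (derM hs.1) (flowD hd) !(flowM hd) !(flowNK hd).
Qed.

Lemma flow_conj t u a :
  flow (dconj d t sigma) u a = flow d t (flow sigma u (flow d (- t) a)).
Proof.
have [j hj] := hs.2 (flow d (- t) a).
rewrite (flowE hs u hj) (flow_sum hd) (@flowE _ (lnil_conj t) u a j); last first.
  by rewrite iter_conj hj (flow0 hd).
by apply: eq_bigr => i _; rewrite iter_conj (flowZ hd).
Qed.

Lemma conj_id : dconj d 0 sigma = sigma.
Proof. by apply: funext => a; rewrite /dconj oppr0 (flow_id hd) (flow_id hd). Qed.

End Conjugation.

Lemma conj_self d t : lnil d -> dconj d t d = d.
Proof.
by move=> hd; apply: funext => a; rewrite /dconj -flow_der // flowNK.
Qed.

Lemma local_slice d : lnil d -> d <> (fun=> 0) ->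
  exists b, d b <> 0 /\ d (d b) = 0.
Proof.
move=> hd nz; have [a da] : exists a, d a <> 0.
  by apply: contrapT => h; apply: nz; apply: funext => a;
     apply: contrapT => da; apply: h; exists a.
have [j] := hd.2 a; elim: j a da => [|j ih] a da hj.
  by case: da; rewrite -[a]/(iter 0 d a) hj (der0 hd.1).
have [dda|dda] := pselect (d (d a) = 0); first by exists a.
by apply: (ih (d a)); rewrite // -iterSr.
Qed.

Lemma iter_derN d i a : derivation d -> iter i d (- a) = - iter i d a.
Proof. by move=> dd; rewrite -scaleN1r (iter_derZ dd) scaleN1r. Qed.

Lemma iter_ker_mul d f a i :
  derivation d -> d f = 0 -> iter i d (f * a) = f * iter i d a.
Proof.
by move=> dd df; elim: i => //= i ->; rewrite (derM dd) df mul0r add0r.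
Qed.

Lemma iter_mul_slice d b (c : L) n : derivation d -> d (d b) = 0 ->
  iter n d (b * c) = b * iter n d c + n%:R * (d b * iter n.-1 d c).
Proof.
move=> hd ddb; elim: n => [|n ih]; first by rewrite mul0r addr0.
rewrite iterS ih (derD hd) !(derM hd) ddb mul0r add0r.
have -> : d n%:R = 0 by rewrite -[n%:R]/(1 *+ n) -scaler_nat (ker_scalar hd).
case: n {ih} => [|n] /=; ring.
Qed.

(** If a derivation kills the kernel of a locally nilpotent sigma, then it is
    proportional to sigma: with a local slice b of sigma, the derivation
    h delta - delta(b) sigma, where h = sigma b, kills ker sigma and b.
    It kills everything by induction on the nilpotency index n + 1 of an element
    a, because n h a - b sigma(a) has a smaller index. *)
Lemma parallel_of_ker (sigma delta : L -> L) :
  (forall a b, a * b = 0 -> a = 0 \/ b = 0) ->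
  lnil sigma -> sigma <> (fun=> 0) -> derivation delta ->
  delta <> (fun=> 0) -> (forall f, sigma f = 0 -> delta f = 0) ->
  exists c h : L, c <> 0 /\ forall a, c * sigma a = h * delta a.
Proof.
move=> dom hs snz dd dnz hker; have [b [hb ssb]] := local_slice hs snz.
have ds := hs.1.
have E a : delta b * sigma a = sigma b * delta a.
  have [j] := hs.2 a; elim: j a => [|[|j] ih] a hj.
  - by rewrite -[a]/(iter 0 sigma a) hj (der0 dd) (der0 ds) !mulr0.
  - by rewrite [sigma a]hj (hker a hj) !mulr0.
  have hsa : iter j.+1 sigma (sigma a) = 0 by rewrite -iterSr.
  set n : L := j.+1%:R; have nE : n = j.+1%:R *: 1 by rewrite scaler_nat.
  have hn (c : L) : c * n = 0 -> c = 0.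
    rewrite nE -scalerAr mulr1 => /(congr1 (fun x => j.+1%:R^-1 *: x)).
    by rewrite scalerA mulVf ?natr_neq0 // scale1r scaler0.
  have dn : delta n = 0 by rewrite nE (ker_scalar dd).
  have sn : sigma n = 0 by rewrite nE (ker_scalar ds).
  have kn : sigma (n * sigma b) = 0 by apply: (ker_mul ds).
  have hr : iter j.+1 sigma (n * sigma b * a - b * sigma a) = 0.
    rewrite -mulN1r (iter_derD ds) mulN1r (iter_derN _ _ ds) (@iter_ker_mul sigma _ _ _ ds kn).
    rewrite (@iter_mul_slice sigma _ _ _ ds ssb) hsa mulr0 add0r /= -/(iter j.+1 sigma a).
    by rewrite -iterSr mulrA subrr.
  have dsb : delta (sigma b) = 0 by apply: hker.
  have := ih _ hr; rewrite (derB dd) (derB ds) !(derM dd) !(derM ds) dn sn ssb dsb.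
  have := ih _ hsa; set x := delta b; set y := sigma b.
  move=> hx hy; apply: subr0_eq; apply: hn.
  suff [] : y = 0 \/ (x * sigma a - y * delta a) * n = 0 by [].
  apply: dom; move: hx hy.
  set u := sigma (sigma a); set v := delta (sigma a) => hx hy.
  rewrite !(mul0r, mulr0, add0r, addr0) in hy.
  have -> : y * ((x * sigma a - y * delta a) * n) =
    x * (n * y * sigma a - (y * sigma a + b * u)) -
    y * (n * y * delta a - (x * sigma a + b * v)) + b * (x * u - y * v) by ring.
  by rewrite hx subrr mulr0 addr0; apply/eqP; rewrite subr_eq0; apply/eqP.
exists (delta b), (sigma b); split=> // db.
case: dnz; apply: funext => a; have := E a; rewrite db mul0r => /esym/dom.
by case.
Qed.

End Flows.

(** * The Zariski topology of X *)

Section Topology.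
Context (k : fieldType) (m : nat) (X : set (affine_space k m)).
Implicit Types (x y z : X) (U V : set X) (p q : {mpoly k[m]}).

Lemma zopenP U : zopen U <->
  forall x, U x -> exists p, p.@[\val x] != 0 /\
    forall y, p.@[\val y] != 0 -> U y.
Proof.
split=> [[S SU] x Ux|h].
  have nSx : ~ zero_locus S (\val x).
    move=> Sx; have : (~` U) x by rewrite SU.
    by apply.
  have [p [Sp /eqP px]] : exists p, S p /\ p.@[\val x] <> 0.
    apply: contrapT => h; apply: nSx => p Sp; apply: contrapT => px.
    by apply: h; exists p.
  exists p; split=> // y /eqP py; apply: contrapT => nUy; apply: py.
  have : (~` U) y by [].
  by rewrite SU => /(_ p Sp).
exists [set p | forall y, ~ U y -> p.@[\val y] = 0].
apply/seteqP; split=> y /=; first by move=> nUy p; apply.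
move=> hy Uy; have [p [/eqP py hp]] := h y Uy; apply: py; apply: hy => z nUz.
by apply: contrapT => /eqP /hp.
Qed.

Lemma zopenT : zopen [set: X].
Proof.
apply/zopenP => x _; exists 1; split=> //; by rewrite meval1 oner_neq0.
Qed.

Lemma zopenI U V : zopen U -> zopen V -> zopen (U `&` V).
Proof.
move=> /zopenP hU /zopenP hV; apply/zopenP => x [/hU[p [px hp]] /hV[q [qx hq]]].
exists (p * q); rewrite mevalM mulf_neq0 //; split=> // y.
by rewrite mevalM mulf_eq0 negb_or => /andP[/hp Uy /hq Vy].
Qed.

Lemma zopen_local U :
  (forall x, U x -> exists V, [/\ zopen V, V x & V `<=` U]) -> zopen U.
Proof.
move=> h; apply/zopenP => x /h[V [/zopenP oV Vx VU]].
have [p [px hp]] := oV x Vx; exists p; split=> // y py; exact/VU/hp.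
Qed.

Lemma zopen_bigI (I : eqType) (r : seq I) (V : I -> set X) :
  (forall i, zopen (V i)) -> zopen [set x | forall i, i \in r -> V i x].
Proof.
move=> oV; elim: r => [|i r ih].
  rewrite (_ : [set x | _] = setT); first exact: zopenT.
  by apply/seteqP; split.
rewrite (_ : [set x | _] = V i `&` [set x | forall i, i \in r -> V i x]).
  exact: zopenI.
apply/seteqP; split=> x /=.
  move=> h; split; first by apply: h; rewrite mem_head.
  by move=> j jr; apply: h; rewrite inE jr orbT.
by move=> [Vi h] j; rewrite inE => /orP[/eqP->|/h].
Qed.

Lemma regular_neq0_open (f : X -> k) :
  regular_on [set: X] f -> zopen [set x | f x != 0].
Proof.
move=> rf; apply: zopen_local => x fx.
have [p [q [V [oV Vx _ hV]]]] := rf x I.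
exists (V `&` [set y | p.@[\val y] != 0]); split.
- by apply: zopenI => //; apply/zopenP => y py; exists p.
- split=> //=; have [qx fE] := hV x Vx; move: fx; rewrite /= fE.
  by apply: contra_neq => ->; rewrite mul0r.
move=> y [Vy py] /=; have [qy ->] := hV y Vy.
by rewrite mulf_neq0 // invr_eq0.
Qed.

Lemma irreducible_meet U V : irreducible [set: X] -> zopen U -> zopen V ->
  U !=set0 -> V !=set0 -> U `&` V !=set0.
Proof.
move=> [_ irr] oU oV [x Ux] [y Vy]; apply: contrapT => UV.
have [|h|h] := irr _ _ oU oV.
- move=> z _; have [Uz|] := pselect (U z); last by left.
  by right=> Vz; apply: UV; exists z.
- exact: (h x).
- exact: (h y).
Qed.

Lemma scheme_point1 x : scheme_point [set x].
Proof.
split; last first.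
  split; first by exists x.
  move=> Z1 Z2 _ _ h; have [|Zx|Zx] := h x; first by [].
    by left=> y ->.
  by right=> y ->.
exists [set p | p.@[\val x] = 0]; apply/seteqP; split=> y /=.
  by move=> -> p.
move=> h; apply/val_inj/funext => i.
have hX z : ('X_i - (\val x i)%:MP).@[\val z] = \val z i - \val x i.
  by rewrite mevalB mevalXU mevalC.
have /h : ('X_i - (\val x i)%:MP).@[\val x] = 0 by rewrite hX subrr.
by rewrite hX => /subr0_eq.
Qed.

Lemma morphism_comp (g h : X -> X) :
  morphism g -> morphism h -> morphism (g \o h).
Proof.
move=> mg mh U oU; have [og rg] := mg U oU; have [oh rh] := mh _ og.
by split=> // f rf; apply: (rh (f \o g)); apply: rg.
Qed.

Lemma automorphism_comp (g h : X -> X) :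
  automorphism g -> automorphism h -> automorphism (g \o h).
Proof.
move=> [g' [gK g'K mg mg']] [h' [hK h'K mh mh']]; exists (h' \o g').
by split; [exact: can_comp | exact: can_comp | exact: morphism_comp..].
Qed.

Lemma automorphism_id : automorphism (@id X).
Proof. by exists id. Qed.

Lemma automorphism_inv (g h : X -> X) :
  automorphism g -> cancel g h -> cancel h g -> automorphism h.
Proof.
move=> [g' [gK g'K mg mg']] gh hg; exists g; split=> //.
by have -> : h = g' by apply: funext => x; rewrite -[x in LHS]g'K gh.
Qed.

Lemma generated_automorphism (S : set (X -> X)) :
  S `<=` (@automorphism k m X) -> generated S `<=` (@automorphism k m X).
Proof.
move=> hS g; elim=> [{}g /hS //||{}g h _ ag _ ah|{}g h _ ag].
- exact: automorphism_id.
- exact: automorphism_comp.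
- exact: automorphism_inv.
Qed.

(** Translating an open subset of an orbit covers the orbit by open sets. *)
Lemma open_orbit (S : set (X -> X)) x U :
  S `<=` (@automorphism k m X) -> zopen U -> U !=set0 ->
  U `<=` orbit_of (generated S) x -> zopen (orbit_of (generated S) x).
Proof.
move=> hS oU [u Uu] UO; apply: zopen_local => y [h Gh hx].
have [h' Gh' h'x] := UO u Uu.
have [l [hK lK mh ml]] := generated_automorphism hS Gh.
have [l' [h'K l'K mh' ml']] := generated_automorphism hS Gh'.
have Gl : generated S l by apply: generated_inv hK lK.
have Gl' : generated S l' by apply: generated_inv h'K l'K.
exists ((h' \o l) @^-1` U); split.
- by have [] := morphism_comp mh' ml oU.
- by rewrite /preimage /= -hx hK h'x.
move=> z /= /UO[g Gg gx]; exists (h \o (l' \o g)).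
  by apply: generated_comp => //; apply: generated_comp.
by rewrite /= gx h'K lK.
Qed.

End Topology.

(** * Linear forms along flows, and words in derivations *)

Section Functionals.
Context (k : fieldType) (char0 : [pchar k] =i pred0) (L : comAlgType k).
Implicit Types (d sigma : L -> L) (a b : L) (t c : k) (p q : {poly k}).

Lemma natr_inj : injective (fun i : nat => i%:R : k).
Proof.
move=> i j; wlog ij : i j / (i <= j)%N.
  by move=> H; have [/H//|/ltnW /H+ /esym] := leqP i j; move=> /[apply].
move=> /eqP; rewrite eq_sym -subr_eq0 -natrB // => /eqP hij.
apply/eqP; rewrite eqn_leq ij -subn_eq0; apply/negPn/negP.
by rewrite -lt0n => /(natr_neq0 char0); rewrite hij eqxx.
Qed.

Lemma nonroot p : p != 0 -> exists t, p.[t] != 0.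
Proof.
move=> p0; apply: contrapT => h.
have := max_poly_roots (rs := [seq i%:R : k | i <- iota 0 (size p)]) p0.
rewrite size_map size_iota ltnn map_inj_uniq ?iota_uniq; last exact: natr_inj.
move=> /(_ _ isT) H.
have /H // : all (root p) [seq i%:R : k | i <- iota 0 (size p)].
apply/allP => _ /mapP[i _ ->]; apply/rootP/eqP/negPn/negP => hi.
by apply: h; exists i%:R.
Qed.

Lemma poly_eq0 p : (forall t, p.[t] = 0) -> p = 0.
Proof.
move=> h; apply/eqP/negPn/negP => /nonroot[t].
by rewrite h eqxx.
Qed.

Definition functional (lambda : L -> k) :=
  forall c a b, lambda (c *: a + b) = c * lambda a + lambda b.

Section Functional.
Context (lambda : L -> k) (hl : functional lambda).

Lemma fun0 : lambda 0 = 0.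
Proof.
have := hl 1 0 0; rewrite scale1r addr0 mul1r => h.
by apply: (@addrI _ (lambda 0)); rewrite -h addr0.
Qed.

Lemma funD a b : lambda (a + b) = lambda a + lambda b.
Proof. by have := hl 1 a b; rewrite scale1r mul1r. Qed.

Lemma funZ c a : lambda (c *: a) = c * lambda a.
Proof. by have := hl c a 0; rewrite fun0 !addr0. Qed.

Lemma fun_sum (I : Type) (r : seq I) (P : pred I) (F : I -> L) :
  lambda (\sum_(i <- r | P i) F i) = \sum_(i <- r | P i) lambda (F i).
Proof. by apply: (big_morph lambda funD fun0). Qed.

Lemma functional_der d : derivation d -> functional (lambda \o d).
Proof. by move=> dd c a b; rewrite /= (derD dd) (derZ dd) funD funZ. Qed.

Lemma functional_iter d n : derivation d -> functional (fun a => lambda (iter n d a)).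
Proof. by move=> dd c a b; rewrite (iter_derD dd) (iter_derZ dd) funD funZ. Qed.

Lemma flow_poly d a : lnil d -> exists p, (forall t, lambda (flow d t a) = p.[t]) /\
  forall i, p`_i = lambda (divpow d i a).
Proof.
move=> hd; have [q hq qE] := flowP hd.
exists (\poly_(i < size (q a)) lambda (q a)`_i); split=> [t|i].
  rewrite qE horner_coef fun_sum horner_poly; apply: eq_bigr => i _.
  by rewrite exprZn expr1n -scalerAr mulr1 funZ mulrC.
rewrite coef_poly; case: ltnP => si; first by rewrite hq.
by rewrite -hq nth_default // fun0.
Qed.

(** The values of a polynomial in t determine its coefficients, as k is
    infinite. *)
Lemma flow_vanish d a n : lnil d -> (forall t, lambda (flow d t a) = 0) ->
  lambda (iter n d a) = 0.
Proof.
move=> hd h; have [p [pE pc]] := flow_poly a hd.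
have p0 : p = 0 by apply: poly_eq0 => t; rewrite -pE.
have := pc n; rewrite p0 coef0 /divpow funZ => /esym/eqP.
by rewrite mulf_eq0 invr_eq0 (negPf (fact_neq0 char0 n)) => /eqP.
Qed.

(** The derivative at t = 0 of the conjugates exp(t d) sigma exp(-t d) is the
    commutator of d and sigma; here it is a coefficient of a polynomial in t. *)
Lemma conj_poly d sigma b : lnil d -> derivation sigma ->
  exists p, (forall t, lambda (dconj d t sigma b) = p.[t]) /\
    p`_1 = lambda (d (sigma b)) - lambda (sigma (d b)).
Proof.
move=> hd ds; have [j hj] := hd.2 b.
have hj2 : iter j.+2 d b = 0 by apply: (iter_der_ge hd.1 _ hj); rewrite ltnW // ltnW.
have [q hq] := choice (fun i => flow_poly (sigma (iter i d b)) hd).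
exists (\sum_(i < j.+2) ((-1) ^+ i / (i`!)%:R) *: (q i * 'X^i)); split=> [t|].
  rewrite /dconj (flowE hd _ hj2) (der_sum ds) (flow_sum hd) fun_sum horner_sum.
  apply: eq_bigr => i _; rewrite (derZ ds) (flowZ hd) funZ (hq i).1.
  rewrite hornerZ hornerM hornerXn (exprNn t).
  by move: ((-1) ^+ i) (t ^+ i) (_^-1) (_.[_]) => u v w z; ring.
rewrite coef_sum 2!big_ord_recl big1 => [|i _]; last first.
  by rewrite coefZ coefMXn !lift0 mulr0.
rewrite addr0 !coefZ !coefMXn !lift0 /= !(hq _).2 /divpow /= expr0 expr1 !fact0.
by rewrite -[1`!]/1%N !invr1 !scale1r !mul1r mulr1 mulN1r.
Qed.

Lemma conj_commutator d sigma b : lnil d -> derivation sigma ->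
  (forall t, lambda (dconj d t sigma b) = 0) ->
  lambda (d (sigma b)) = lambda (sigma (d b)).
Proof.
move=> hd ds h; have [p [pE p1]] := conj_poly b hd ds.
have p0 : p = 0 by apply: poly_eq0 => t; rewrite -pE.
by apply: subr0_eq; rewrite -p1 p0 coef0.
Qed.

End Functional.

Context (N : set (L -> L)) (hN : forall d, N d -> lnil d).
Context (Nconj : forall d t sigma, N d -> N sigma -> N (dconj d t sigma)).

Definition word (ws : seq N) a : L := foldr (fun w b => \val w b) a ws.

Lemma word_cat u v a : word (u ++ v) a = word u (word v a).
Proof. by rewrite /word foldr_cat. Qed.

Lemma letter_in (w : N) : N (\val w).
Proof. exact: set_mem (valP w). Qed.

Lemma letter_lnil (w : N) : lnil (\val w).
Proof. exact/hN/letter_in. Qed.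

Definition to_N d (h : N d) : N := exist _ d (mem_set h).

Lemma functional_word lambda u :
  functional lambda -> functional (fun a => lambda (word u a)).
Proof.
move=> hl; elim: u lambda hl => [|w u ih] lambda hl //=.
exact: (ih _ (functional_der hl (letter_lnil w).1)).
Qed.

Section ShortestWord.
Context (lambda : L -> k) (hl : functional lambda) (a : L) (j : nat).
Context (short : forall w, (size w < j)%N -> lambda (word w a) = 0).

(** Exchanging two neighbours of a shortest nonvanishing word changes it by a
    word containing a commutator. The latter is the linear coefficient in t of
    a word in which a conjugate, again in [N], takes the place of the two
    letters; that word is too short not to vanish. *)
Lemma word_swap u w w' v : size (u ++ w :: w' :: v) = j ->
  lambda (word (u ++ w :: w' :: v) a) = lambda (word (u ++ w' :: w :: v) a).
Proof.
move=> sz; rewrite !word_cat /=.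
apply: (conj_commutator (functional_word u hl) (letter_lnil w) (letter_lnil w').1) => t.
pose c := to_N (Nconj t (letter_in w) (letter_in w')).
have := short (w := u ++ c :: v); rewrite word_cat; apply.
by rewrite -sz !size_cat /= ltn_add2l.
Qed.

Lemma word_move u w v v' : size (u ++ w :: v ++ v') = j ->
  lambda (word (u ++ w :: v ++ v') a) = lambda (word (u ++ v ++ w :: v') a).
Proof.
elim: v u => //= w' v ih u sz.
rewrite word_swap // -cat_rcons ih ?cat_rcons //.
by rewrite -sz !size_cat /= !size_cat /=; lia.
Qed.

Lemma word_perm (I : eqType) (e : I -> N) (s s' : seq I) u :
  perm_eq s s' -> size (u ++ map e s) = j ->
  lambda (word (u ++ map e s) a) = lambda (word (u ++ map e s') a).
Proof.
elim: s s' u => [|i s ih] s' u; first by rewrite perm_sym => /perm_nilP ->.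
move=> ss' sz; have is' : i \in s' by rewrite -(perm_mem ss') mem_head.
case/splitPr: is' ss' => s1 s2; rewrite perm_sym perm_catC /= perm_cons perm_catC perm_sym.
move=> ss; rewrite /= -cat_rcons (ih (s1 ++ s2)) ?cat_rcons //.
rewrite !map_cat /= word_move // -sz !size_cat /= -map_cat !size_map.
by rewrite (perm_size ss).
Qed.

(** A shortest nonvanishing word is multilinear in the values of its letters
    at the point, so its letters may be taken in a family that spans them. *)
Lemma word_in_span n (e : 'I_n -> N) u (s : seq 'I_n) :
  (forall w : N, exists c : 'I_n -> k, forall b,
     lambda (\val w b) = \sum_i c i * lambda (\val (e i) b)) ->
  size (u ++ map e s) = j -> lambda (word (u ++ map e s) a) <> 0 ->
  exists s' : seq 'I_n, size s' = j /\ lambda (word (map e s') a) <> 0.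
Proof.
move=> span; elim: u s => [|w u ih] s sz hw.
  by exists s; split=> //; rewrite -sz size_map.
have [c hc] := span w.
have [i hi] : exists i, lambda (word (e i :: u ++ map e s) a) <> 0.
  apply: contrapT => h; apply: hw; rewrite /= hc big1 // => i _.
  rewrite [X in _ * X](_ : _ = 0) ?mulr0 //; apply: contrapT => hi.
  by apply: h; exists i.
have sz' : size ([::] ++ e i :: u ++ map e s) = j by rewrite -sz.
by apply: (ih (i :: s)); [rewrite -sz !size_cat /= addnS | rewrite -(word_move sz')].
Qed.

End ShortestWord.

Fixpoint flows (es : seq (L -> L)) (ts : seq k) a : L :=
  match es, ts with
  | e :: es', t :: ts' => flow e t (flows es' ts' a)
  | _, _ => a
  end.

Fixpoint powers (es : seq (L -> L)) (ns : seq nat) a : L :=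
  match es, ns with
  | e :: es', n :: ns' => iter n e (powers es' ns' a)
  | _, _ => a
  end.

(** The powers of the derivations are coefficients of the flows, which are
    extracted one variable at a time. *)
Lemma powers_vanish es ns a lambda : functional lambda ->
  (forall e, List.In e es -> lnil e) ->
  size ns = size es ->
  (forall ts, size ts = size es -> lambda (flows es ts a) = 0) ->
  lambda (powers es ns a) = 0.
Proof.
elim: es ns lambda => [|e es ih] [|n ns] lambda hl hes //=; first by move=> _ /(_ [::]); exact.
move=> [sz] h; have he : lnil e by apply: hes; left.
apply: (ih ns (fun b => lambda (iter n e b))) => //.
- by apply: functional_iter => //; exact: he.1.
- by move=> e' he'; apply: hes; right.
move=> ts sts; apply: (flow_vanish hl) => // t.
by apply: (h (t :: ts)); rewrite /= sts.
Qed.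

(** Up to factorials, the values of lambda on the sorted words applied to a are
    the coefficients of its values on the products of flows; a shortest
    nonvanishing word can be brought into this sorted form. *)
Lemma flows_injective n (e : 'I_n -> N) (lambda : L -> k) a :
  functional lambda ->
  (forall w : N, exists c : 'I_n -> k, forall b,
     lambda (\val w b) = \sum_i c i * lambda (\val (e i) b)) ->
  (exists ws, lambda (word ws a) <> 0) ->
  exists ts, size ts = n /\
    lambda (flows [seq \val (e i) | i <- enum 'I_n] ts a) <> 0.
Proof.
move=> hl span [ws hws].
have : exists j, `[< exists w, size w = j /\ lambda (word w a) <> 0 >].
  by exists (size ws); apply/asboolP; exists ws.
case/ex_minnP => j /asboolP[w [sw hw]] jmin.
have short v : (size v < j)%N -> lambda (word v a) = 0.
  move=> sv; apply: contrapT => hv; have := jmin (size v).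
  by rewrite leqNgt sv; move=> /(_ _)/negP; apply=> //; apply/asboolP; exists v.
have [|| s [ss hs]] := word_in_span hl short (u := w) (s := [::]) span; rewrite ?cats0 //.
(* s' is the sorted rearrangement of s. *)
pose c i := count_mem i s; pose s' := flatten [seq nseq (c i) i | i <- enum 'I_n].
have ps : perm_eq s s'.
  rewrite /perm_eq; apply/allP => i _ /=; apply/eqP.
  rewrite /s' count_flatten -map_comp sumnE big_map big_enum /= (bigD1 i) //=.
  rewrite count_nseq /= eqxx mul1n big1 ?addn0 // => l li.
  by rewrite count_nseq /= (negPf li).
have E : lambda (word (map e s) a) = lambda (word (map e s') a).
  by apply: (word_perm hl short (u := [::]) ps); rewrite size_map.
apply: contrapT => h; apply: hs; rewrite E.
have -> : word (map e s') a = powers [seq \val (e i) | i <- enum 'I_n] (map c (enum 'I_n)) a.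
  rewrite /s'; elim: (enum 'I_n) => //= i r ih; rewrite map_cat word_cat ih map_nseq.
  by elim: (c i) => //= q ->.
apply: powers_vanish => //; last 2 first.
- by rewrite !size_map.
- move=> ts; rewrite size_map size_enum_ord => sts; apply: contrapT => hts.
  by apply: h; exists ts.
by elim: (enum 'I_n) => //= i r ih d [<-|/ih //]; apply: letter_lnil.
Qed.

End Functionals.

(** * The algebra of functions and the flows on X *)

Section Embedded.
Context (k : fieldType) (char0 : [pchar k] =i pred0).
Context (m : nat) (X : set (affine_space k m)) (hX : quasi_affine_variety X).
Context (L : comAlgType k) (ev : X -> {lrmorphism L -> k^o}).
Context (hL : algebra_of_regular_functions ev) (hemb : open_embedding ev).
Implicit Types (x y z : X) (U V : set X) (a b : L) (d : L -> L) (t : k).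

Lemma evZ x t a : ev x (t *: a) = t * ev x a.
Proof. exact: linearZ. Qed.

Lemma ev0 x : ev x 0 = 0.
Proof. exact: rmorph0. Qed.

Lemma ev1 x : ev x 1 = 1.
Proof. exact: rmorph1. Qed.

Lemma evD x a b : ev x (a + b) = ev x a + ev x b.
Proof. exact: rmorphD. Qed.

Lemma evB x a b : ev x (a - b) = ev x a - ev x b.
Proof. exact: rmorphB. Qed.

Lemma evM x a b : ev x (a * b) = ev x a * ev x b.
Proof. exact: rmorphM. Qed.

Lemma ev_scalar x t : ev x (t *: 1) = t.
Proof. by rewrite evZ ev1 mulr1. Qed.

Lemma ev_eq0 a : (forall x, ev x a = 0) -> a = 0.
Proof. by move=> h; apply: hL.1 => x; rewrite h ev0. Qed.

Lemma ev_neq0 a : a <> 0 -> exists x, ev x a <> 0.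
Proof.
by move=> a0; apply: contrapT => h; apply/a0/ev_eq0 => x; apply: contrapT => hx;
  apply: h; exists x.
Qed.

Lemma ev_open a : zopen [set x | ev x a != 0].
Proof. exact: (regular_neq0_open (hL.2 a)). Qed.

Lemma eq0_on_open V a :
  zopen V -> V !=set0 -> (forall y, V y -> ev y a = 0) -> a = 0.
Proof.
move=> oV V0 Va; apply: contrapT => /ev_neq0[x /eqP ax].
have [|y [Vy]] := irreducible_meet hX.2 oV (ev_open a) V0; first by exists x.
by rewrite /= Va // eqxx.
Qed.

Lemma L_domain a b : a * b = 0 -> a = 0 \/ b = 0.
Proof.
move=> ab; have [->|/ev_neq0[x /eqP ax]] := pselect (a = 0); first by left.
right; apply: (eq0_on_open (ev_open a)) => [|y /= ay]; first by exists x.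
apply/eqP; have /eqP := congr1 (ev y) ab.
by rewrite evM ev0 mulf_eq0 (negPf ay).
Qed.

Lemma ev_inj x y : (forall a, ev x a = ev y a) -> x = y.
Proof.
move=> h; have [inj _ _ _] := hemb.
have /(_ _)/(congr1 (@^~ y)) := inj _ _ (scheme_point1 x) (scheme_point1 y).
have -> : to_spec ev [set x] = to_spec ev [set y].
  by apply/seteqP; split=> a /= ha _ ->; have := ha _ erefl; rewrite h.
by move=> /(_ erefl) e; have : [set x] y by rewrite e.
Qed.

Lemma prime_point x : prime_ideal (to_spec ev [set x]).
Proof.
split.
- split; first by move=> y _; rewrite ev0.
  by move=> /(_ x erefl)/eqP; rewrite ev1 oner_eq0.
- by move=> a b ha hb y xy; rewrite evD ha // hb // addr0.
- by move=> a b hb y xy; rewrite evM hb // mulr0.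
move=> a b /(_ x erefl)/eqP; rewrite evM mulf_eq0.
by move=> /orP[]/eqP ha; [left|right] => y ->.
Qed.

(** Openness of the image in Spec [L] gives s in [L] that cuts out a
    neighbourhood of x there; injectivity brings this back to [X]. *)
Lemma basic_open U x : zopen U -> U x ->
  exists v, ev x v != 0 /\ forall z, ev z v != 0 -> U z.
Proof.
move=> oU Ux; have [inj op _ _] := hemb; have [S SE] := op U oU.
have [_ nS] : [set p | prime_ideal p /\ ~ S `<=` p] (to_spec ev [set x]).
  by rewrite -SE; exists [set x] => //; split; [exact: scheme_point1 | exists x].
have [v [Sv vx]] : exists v, S v /\ ev x v <> 0.
  apply: contrapT => h; apply: nS => v Sv y ->; apply: contrapT => vx.
  by apply: h; exists v.
exists v; split=> [|z /eqP zv]; first exact/eqP.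
have [Z [sZ [y [Zy Uy]]] ZE] : (to_spec ev @` [set Z | scheme_point Z /\ Z `&` U !=set0]) (to_spec ev [set z]).
  by rewrite SE; split; [exact: prime_point | move=> /(_ v Sv z erefl)].
have ZzE := inj _ _ sZ (scheme_point1 z) ZE.
by move: Zy Uy; rewrite ZzE => ->.
Qed.

Lemma regular_germ U (f : X -> k) x : zopen U -> U x -> regular_on U f ->
  exists (a s : L) V, [/\ zopen V, V x, V `<=` U &
    forall y, V y -> ev y s != 0 /\ f y = ev y a / ev y s].
Proof.
move=> oU Ux rf; have [_ _ loc _] := hemb.
have xU : [set x] `&` U !=set0 by exists x.
have [a [s [V [_ oV VU [y [yx Vy]] hV]]]] := loc _ _ _ (scheme_point1 x) oU xU rf.
by exists a, s, V; split=> //; rewrite -(yx : y = x).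
Qed.

(** The topology and the regular functions of [X] are determined by [L], so a
    map that pulls [L] back into itself is a morphism. *)
Lemma morphism_of_comorphism (g : X -> X) (gamma : L -> L) :
  (forall x a, ev (g x) a = ev x (gamma a)) -> morphism g.
Proof.
move=> gE; have og U : zopen U -> zopen (g @^-1` U).
  move=> oU; apply: zopen_local => x Ux.
  have [v [vx hv]] := basic_open oU Ux.
  exists [set z | ev z (gamma v) != 0]; split; first exact: ev_open.
    by rewrite /= -gE.
  by move=> z /=; rewrite -gE => /hv.
move=> U oU; split=> [|f rf x Ux]; first exact: og.
have [a [s [V [oV Vx VU hV]]]] := regular_germ oU Ux rf.
have [p1 [q1 [V1 [oV1 V1x _ h1]]]] := hL.2 (gamma a) x I.
have [p2 [q2 [V2 [oV2 V2x _ h2]]]] := hL.2 (gamma s) x I.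
exists (p1 * q2), (q1 * p2), (V1 `&` V2 `&` (g @^-1` V)); split.
- by apply: zopenI; [exact: zopenI | exact: og].
- by [].
- by move=> y [_ /VU].
move=> y [[/h1[q1y aE] /h2[q2y sE]] /hV[sy fE]].
have p2y : p2.@[\val y] != 0.
  by move: sy; rewrite gE sE mulf_eq0 negb_or => /andP[].
rewrite !mevalM mulf_neq0 //; split=> //.
by rewrite /= fE !gE aE sE; field; rewrite q1y q2y p2y.
Qed.

(** A locally nilpotent derivation preserving the boundary ideal integrates to
    an action on [X]: the pullback of the maximal ideal of x under exp(t d) is
    a prime that cannot lie in the complement of the open set [X], since
    exp(-t d) preserves the ideal of this complement; being the kernel of a
    map to k, it is the ideal of a point. *)
Lemma flow_point d t x : LND ev d -> exists y, forall a, ev y a = ev x (flow d t a).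
Proof.
move=> [dd nd bd]; have hd : lnil d by [].
have [_ op _ _] := hemb; have [S SE] := op _ (zopenT X).
set im := to_spec ev @` _ in SE.
have imE p : im p <-> (to_spec ev @` [set Z | scheme_point Z]) p.
  split=> -[Z hZ <-]; exists Z => //; first by case: hZ.
  by split=> //; have [_ [[z Zz] _]] := hZ; exists z.
(* The pullback of the ideal of x under exp(t d). *)
pose q : set L := [set a | ev x (flow d t a) = 0].
have q_prime : prime_ideal q.
  rewrite /q; split.
  - by rewrite /= (flow0 hd) (flow1 hd) ev0 ev1; split=> //; apply/eqP/oner_neq0.
  - by move=> a b /= ha hb; rewrite (flowD hd) evD ha hb addr0.
  - by move=> a b /= hb; rewrite (flowM char0 hd) evM hb mulr0.
  move=> a b /= /eqP; rewrite (flowM char0 hd) evM mulf_eq0.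
  by move=> /orP[]/eqP; [left|right].
have bZ c a : boundary_ideal ev a -> boundary_ideal ev (c *: a).
  move=> ba p pp np; have [_ _ hM _] := pp.
  by rewrite -[a]mul1r scalerAl; apply: hM; apply: ba.
have b0 : boundary_ideal ev 0 by move=> p [[]].
have bD a b : boundary_ideal ev a -> boundary_ideal ev b -> boundary_ideal ev (a + b).
  by move=> ba bb p pp np; have [_ hD _ _] := pp; apply: hD; [apply: ba | apply: bb].
have bflow u a : boundary_ideal ev a -> boundary_ideal ev (flow d u a).
  move=> ba; have [j hj] := nd a; rewrite (flowE hd u hj).
  elim/big_rec: _ => // i b _ bb; apply: bD => //; apply: bZ.
  by elim: (i : nat) => //= l; apply: bd.
have imq : im q.
  apply: contrapT => nq.
  have qb a : boundary_ideal ev a -> q a by apply=> // /imE.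
  have [_ []] : [set p | prime_ideal p /\ ~ S `<=` p] (to_spec ev [set x]).
    rewrite -SE; exists [set x] => //; split; first exact: scheme_point1.
    by exists x.
  move=> s Ss _ ->.
  have bs : boundary_ideal ev s.
    move=> p pp np; apply: contrapT => ps; apply: np; apply/imE.
    by rewrite SE; split=> // /(_ s Ss).
  by have := qb _ (bflow (- t) s bs); rewrite /q /= (flowNK char0 hd).
have [Z [[_ [[y Zy] _]] _] ZE] := imq.
exists y => a; have : q (a - ev x (flow d t a) *: 1).
  by rewrite /q /= (flowB hd) (flowZ hd) (flow1 hd) evB ev_scalar subrr.
by rewrite -ZE => /(_ y Zy); rewrite evB ev_scalar => /subr0_eq.
Qed.

Lemma flow_automorphism d t : LND ev d ->
  exists g, exp_subgroup ev d g /\ forall x a, ev (g x) a = ev x (flow d t a).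
Proof.
move=> ld; have hd : lnil d by case: ld.
have [g gE] := choice (fun x => flow_point t x ld).
have [h hE] := choice (fun x => flow_point (- t) x ld).
exists g; split=> //; split; last first.
  by exists t => a j hj x; rewrite gE (flowE hd t hj).
exists h; split.
- by move=> x; apply: ev_inj => a; rewrite hE gE (flowNK char0 hd).
- by move=> x; apply: ev_inj => a; rewrite gE hE (flowK char0 hd).
- exact: morphism_of_comorphism gE.
- exact: morphism_of_comorphism hE.
Qed.

Lemma exp_subgroup_flow d g : lnil d -> exp_subgroup ev d g ->
  exists t, forall x a, ev (g x) a = ev x (flow d t a).
Proof.
move=> hd [_ [t ht]]; exists t => x a; have [j hj] := hd.2 a.
by rewrite (ht a j hj) (flowE hd t hj).
Qed.

(** * Tangent vectors and the rank of a family of derivations *)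

(** The coordinate functions are regular, hence locally fractions of elements
    of [L]; a single v serves for all of them as there are finitely many. *)
Lemma local_coordinates x : exists (alpha beta : 'I_m -> L) (v : L), ev x v != 0 /\
  forall z, ev z v != 0 -> forall i,
    ev z (beta i) != 0 /\ \val z i = ev z (alpha i) / ev z (beta i).
Proof.
have reg i : regular_on [set: X] (fun z => \val z i).
  move=> z _; exists 'X_i, 1, setT; split=> //; first exact: (zopenT X).
  by move=> y _; rewrite meval1 mevalXU divr1 oner_neq0.
have /choice[F hF] : forall i, exists F : L * L * set X,
    [/\ zopen F.2, F.2 x & forall y, F.2 y ->
      ev y F.1.2 != 0 /\ \val y i = ev y F.1.1 / ev y F.1.2].
  move=> i; have [a [s [V [oV Vx _ hV]]]] := regular_germ (x := x) (zopenT X) I (reg i).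
  by exists (a, s, V).
have oF i : zopen (F i).2 by case: (hF i).
have oW := zopen_bigI (enum 'I_m) oF.
have [|v [vx hv]] := basic_open oW (x := x); first by move=> i _; case: (hF i).
exists (fun i => (F i).1.1), (fun i => (F i).1.2), v; split=> // z /hv/= hz i.
by have [_ _] := hF i; apply; apply: hz; rewrite mem_enum.
Qed.

Definition point_derivation x (xi : L -> k) :=
  functional xi /\ forall a b, xi (a * b) = xi a * ev x b + ev x a * xi b.

Lemma point_derivationM0 x xi a b : point_derivation x xi ->
  xi a = 0 -> xi b = 0 -> xi (a * b) = 0.
Proof. by move=> [_ h] ha hb; rewrite h ha hb mul0r mulr0 addr0. Qed.

(** Every element of [L] is locally a rational function of the local coordinates,
    and the derivative of a fraction follows from those of its terms. *)
Lemma point_derivation_eq0 x xi (alpha beta : 'I_m -> L) v :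
  point_derivation x xi -> ev x v != 0 ->
  (forall z, ev z v != 0 -> forall i,
    ev z (beta i) != 0 /\ \val z i = ev z (alpha i) / ev z (beta i)) ->
  (forall i, xi (alpha i) = 0) -> (forall i, xi (beta i) = 0) ->
  forall a, xi a = 0.
Proof.
move=> hxi vx hv xa xb a; have [fxi lxi] := hxi.
have xi1 : xi 1 = 0.
  have := lxi 1 1; rewrite mulr1 ev1 mulr1 mul1r => h.
  by apply: (@addrI _ (xi 1)); rewrite -h addr0.
have xiC c : xi (c *: 1) = 0 by rewrite (funZ fxi) xi1 mulr0.
(* Numerators and denominators are taken in the kernel of xi. *)
have frac p : exists P s : L, [/\ xi P = 0, xi s = 0, ev x s != 0 &
    forall z, ev z v != 0 -> ev z s * p.@[\val z] = ev z P].
  pose C (q : {mpoly k[m]}) := exists P s : L, [/\ xi P = 0, xi s = 0, ev x s != 0 &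
    forall z, ev z v != 0 -> ev z s * q.@[\val z] = ev z P].
  have CC c : C c%:MP.
    exists (c *: 1), 1; split; rewrite ?xiC ?xi1 ?ev1 ?oner_neq0 // => z _.
    by rewrite mevalC ev1 mul1r ev_scalar.
  have CD p1 p2 : C p1 -> C p2 -> C (p1 + p2).
    move=> [P1 [s1 [h1 k1 n1 e1]]] [P2 [s2 [h2 k2 n2 e2]]].
    exists (P1 * s2 + P2 * s1), (s1 * s2); split.
    - by rewrite (funD fxi) !(point_derivationM0 hxi) ?addr0.
    - exact: (point_derivationM0 hxi).
    - by rewrite evM mulf_neq0.
    by move=> z hz; rewrite evD !evM mevalD -e1 // -e2 //; ring.
  have CM p1 p2 : C p1 -> C p2 -> C (p1 * p2).
    move=> [P1 [s1 [h1 k1 n1 e1]]] [P2 [s2 [h2 k2 n2 e2]]].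
    exists (P1 * P2), (s1 * s2); split.
    - exact: (point_derivationM0 hxi).
    - exact: (point_derivationM0 hxi).
    - by rewrite evM mulf_neq0.
    by move=> z hz; rewrite !evM mevalM -e1 // -e2 //; ring.
  have CX i : C 'X_i.
    exists (alpha i), (beta i); split=> //; first by have [] := hv x vx i.
    by move=> z hz; have [b0 xE] := hv z hz i; rewrite mevalXU xE mulrCA divff ?mulr1.
  elim/mpolyind: p => [|c mm p _ _ Cp]; first by rewrite -mpolyC0; apply: CC.
  apply: CD => //; rewrite -mul_mpolyC; apply: (CM _ _) => //.
  rewrite mpolyXE_id; elim/big_rec: _ => [|i q _ Cq]; first exact: (CC 1).
  by apply: (CM _ _) => //; elim: (mm i) => [|n ih]; [exact: (CC 1) | rewrite exprS; apply: (CM _ _)].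
have [p [q [V [oV Vx _ hV]]]] := hL.2 a x I.
have [P [s [xP xs sx hP]]] := frac p; have [Q [r [xQ xr rx hQ]]] := frac q.
have E : Q * s * a = P * r.
  apply: subr0_eq; apply: (@eq0_on_open (V `&` [set z | ev z v != 0])).
  - by apply: zopenI => //; apply: ev_open.
  - by exists x.
  move=> y [/hV[qy aE] /= vy]; rewrite evB !evM aE -hP // -hQ //.
  by rewrite [X in X - _](_ : _ = ev y r * ev y s * p.@[\val y] * (q.@[\val y] / q.@[\val y]));
    [rewrite divff //; ring | ring].
have [qx _] := hV x Vx.
have : xi (Q * s * a) = 0 by rewrite E (point_derivationM0 hxi).
rewrite lxi (point_derivationM0 hxi) // mul0r add0r evM -hQ // => /eqP.
by rewrite !mulf_eq0 (negPf rx) (negPf qx) (negPf sx) => /eqP.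
Qed.

Lemma ev_functional x : functional (ev x).
Proof. by move=> c a b; rewrite evD evZ. Qed.

Lemma point_derivation_der x d : derivation d -> point_derivation x (fun a => ev x (d a)).
Proof.
move=> dd; split; last by move=> a b; rewrite (derM dd) evD !evM.
by move=> c a b; rewrite (derD dd) (derZ dd) evD evZ.
Qed.

Lemma ev_det x s (A : 'M[L]_s) : ev x (\det A) = \det (\matrix_(i, j) ev x (A i j)).
Proof.
by rewrite -[ev x _]/((ev x : {rmorphism L -> k}) _) -det_map_mx; congr (\det _);
  apply/matrixP => i j; rewrite !mxE.
Qed.

Section Rank.
Context (N : set (L -> L)) (hN : forall d, N d -> derivation d).

(** The rank of the [L]-module spanned by [N], measured by its minors. *)
Definition rank_ge s := exists (sigma : 'I_s -> L -> L) (a : 'I_s -> L),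
  (forall i, N (sigma i)) /\ \det (\matrix_(i, j) sigma i (a j)) <> 0.

(** At a point, the tangent vectors embed into the space of their values on
    the 2m elements of [L] that give local coordinates. *)
Lemma rank_bounded s : rank_ge s -> (s <= m + m)%N.
Proof.
move=> [sigma [a [hs /ev_neq0[x]]]]; rewrite ev_det => /eqP D0.
have [alpha [beta [v [vx hv]]]] := local_coordinates x.
pose A := \matrix_(i < s, j < m) ev x (sigma i (alpha j)).
pose B := \matrix_(i < s, j < m) ev x (sigma i (beta j)).
have [//|lt_s] := leqP s (m + m); exfalso.
have : kermx (row_mx A B) != 0.
  rewrite kermx_eq0 /row_free; apply: contraL lt_s => /eqP <-.
  by rewrite -leqNgt rank_leq_col.
move=> /rowV0Pn[c /sub_kermxP].
rewrite mul_mx_row => /eqP; rewrite row_mx_eq0 => /andP[/eqP cA /eqP cB] /negP[].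
pose xi b := \sum_i c ord0 i * ev x (sigma i b).
have dxi : point_derivation x xi.
  have dx i := point_derivation_der x (hN (hs i)).
  split=> [e b b'|b b']; rewrite /xi.
    rewrite mulr_sumr -big_split /=; apply: eq_bigr => i _.
    by rewrite (dx i).1; ring.
  rewrite mulr_suml mulr_sumr -big_split /=; apply: eq_bigr => i _.
  by rewrite (dx i).2; ring.
have xi0 : forall b, xi b = 0.
  apply: (point_derivation_eq0 dxi vx hv) => l.
    have /matrixP/(_ ord0 l) := cA; rewrite !mxE => <-.
    by apply: eq_bigr => i _; rewrite mxE.
  have /matrixP/(_ ord0 l) := cB; rewrite !mxE => <-.
  by apply: eq_bigr => i _; rewrite mxE.
pose M := \matrix_(i, j) ev x ((\matrix_(i, j) sigma i (a j)) i j).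
have Mu : M \in unitmx by rewrite unitmxE unitfE.
rewrite -[c](mulmxK Mu) (_ : c *m M = 0) ?mul0mx //.
apply/matrixP => i j; rewrite !mxE ord1 -[RHS](xi0 (a j)).
by apply: eq_bigr => l _; rewrite !mxE.
Qed.

Lemma max_rank : exists s, rank_ge s /\ ~ rank_ge s.+1.
Proof.
apply: contrapT => h.
have R s : rank_ge s.
  elim: s => [|s ih]; last by apply: contrapT => ns; apply: h; exists s.
  exists (fun _ _ => 0), (fun _ => 0); split; first by case.
  by rewrite det_mx00; apply/eqP/oner_neq0.
by have := rank_bounded (R (m + m).+1); rewrite ltnn.
Qed.

(** At a point where a minor of maximal size does not vanish, the
    corresponding derivations span the values of all of [N]: expand the
    vanishing minors of the next size along their last column. *)
Lemma tangent_span x s (sigma : 'I_s -> L -> L) (a : 'I_s -> L) :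
  ~ rank_ge s.+1 -> (forall i, N (sigma i)) ->
  \det (\matrix_(i, j) ev x (sigma i (a j))) != 0 ->
  forall tau, N tau -> exists c : 'I_s -> k, forall b,
    ev x (tau b) = \sum_i c i * ev x (sigma i b).
Proof.
move=> nr hs D0 tau Ntau.
pose S i := oapp sigma tau (unlift ord_max i).
pose M b : 'M[k]_s.+1 := \matrix_(i, j) ev x (S i (oapp a b (unlift ord_max j))).
have SN i : N (S i) by rewrite /S; case: (unlift _ i) => /=.
have M0 b : \det (M b) = 0.
  apply: contrapT => h; apply: nr; exists S, (fun j => oapp a b (unlift ord_max j)).
  split=> // h0; apply: h; have := congr1 (ev x) h0; rewrite ev0 ev_det => <-.
  by congr (\det _); apply/matrixP => i j; rewrite !mxE.
pose K i := cofactor (M 0) i ord_max.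
have KE b i : cofactor (M b) i ord_max = K i.
  rewrite /K /cofactor; congr (_ * \det _); apply/matrixP => p q.
  by rewrite !mxE !liftK.
have Kmax : K ord_max != 0.
  rewrite (_ : K _ = \det (\matrix_(i, j) ev x (sigma i (a j)))) //.
  rewrite /K /cofactor -signr_odd addnn odd_double expr0 mul1r; congr (\det _).
  by apply/matrixP => p q; rewrite !mxE /S !liftK.
exists (fun i => - K (lift ord_max i) / K ord_max) => b.
have := expand_det_col (M b) ord_max; rewrite M0 (bigD1_ord ord_max) //=.
rewrite KE mxE /S unlift_none /= => /esym/eqP; rewrite addr_eq0 => /eqP E.
apply: (mulIf Kmax); rewrite E mulr_suml -sumrN; apply: eq_bigr => i _.
rewrite KE mxE /S liftK unlift_none /=.
by field.
Qed.

End Rank.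

(** * Transitivity, and open sets in images of products of flows *)

(** A function killed at x by all words in [N] is killed by all words at every
    point of the orbit of x, because exp(t d) a is a combination of the d^i a.
    Being zero everywhere, it is the zero function. *)
Lemma transitive_word (N : set (L -> L)) x a :
  (forall d, N d -> lnil d) -> transitive_on (group_of ev N) -> a <> 0 ->
  exists ws : seq N, ev x (word ws a) <> 0.
Proof.
move=> hN htr a0; pose vanish y b := forall ws : seq N, ev y (word ws b) = 0.
have vflow y b d t : N d -> vanish y b -> forall ws : seq N, ev y (flow d t (word ws b)) = 0.
  move=> Nd vb ws; have [j hj] := (hN d Nd).2 (word ws b).
  rewrite (flowE (hN d Nd) t hj) (fun_sum (ev_functional y)) big1 // => i _.
  rewrite evZ (_ : iter i d _ = word (nseq i (to_N Nd) ++ ws) b) ?vb ?mulr0 //.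
  by rewrite word_cat; elim: (i : nat) => //= l ->.
have inv g : group_of ev N g -> forall y b, vanish y b <-> vanish (g y) b.
  elim=> [{}g [d Nd /(exp_subgroup_flow (hN d Nd))[t gE]] y b|//||].
  - split=> vb ws; first by rewrite gE; apply: vflow.
    rewrite -[word ws b](flowNK char0 (hN d Nd) t) -gE; exact: vflow.
  - by move=> {}g h _ ig _ ih y b; rewrite ih; apply: ig.
  by move=> {}g h _ ig gh hg y b; rewrite (ig (h y)) hg.
apply: contrapT => nw; have [y /= ya] := ev_neq0 a0; apply: ya.
have [g Gg <-] := htr x y.
have vx : vanish x a by move=> ws; apply: contrapT => h; apply: nw; exists ws.
by have /(_ [::]) := (inv g Gg x a).1 vx.
Qed.

Lemma flows_point es ts x : (forall e, List.In e es -> LND ev e) ->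
  exists y, forall a, ev y a = ev x (flows es ts a).
Proof.
elim: es ts x => [|e es ih] ts x hes; first by exists x.
case: ts => [|t ts]; first by exists x.
have [y yE] := flow_point t x (hes e (or_introl erefl)).
have [|z zE] := ih ts y; first by move=> e' he'; apply: hes; right.
by exists z => a; rewrite zE yE.
Qed.

(** Expanding the exponentials from the innermost one outwards leaves a finite
    combination of fixed elements of [L], with monomials in the times, which are
    first-order terms, as coefficients. *)
Lemma flows_terms (es : seq (L -> L)) c a : (forall e, List.In e es -> lnil e) ->
  exists ps : seq (GRing.term k * L), all (fun p => GRing.rterm p.1) ps /\
    forall (env ts : seq k), size ts = size es ->
      (forall i, (i < size es)%N -> env`_(c + i) = ts`_i) ->
      flows es ts a = \sum_(p <- ps) GRing.eval env p.1 *: p.2.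
Proof.
elim: es c => [|e es ih] c hes.
  exists [:: (GRing.Const 1, a)]; split=> // env ts _ _.
  by rewrite big_seq1 /= scale1r; case: ts.
have he : lnil e by apply: hes; left.
have [|ps [rps hps]] := ih c.+1; first by move=> e' he'; apply: hes; right.
have [J hJ] := choice he.2.
pose F (p : GRing.term k * L) i : GRing.term k * L :=
  (GRing.Mul p.1 (GRing.Exp (GRing.Var k c) i), divpow e i p.2).
exists [seq F p i | p <- ps, i <- iota 0 (J p.2)]; split.
  elim: ps rps {hps} => //= p ps ihp /andP[rp rps]; rewrite all_cat ihp // andbT.
  by rewrite all_map; apply/allP => i _ /=; rewrite rp.
move=> env [//|t ts] [sts] henv /=.
rewrite (hps env ts) // => [|i hi]; last by rewrite addSnnS (henv i.+1).
rewrite big_allpairs_dep (flow_sum he); apply: eq_bigr => p _.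
rewrite (flowZ he) (flowE he t (hJ p.2)) scaler_sumr.
rewrite -(big_mkord xpredT (fun i => GRing.eval env p.1 *: ((t ^+ i / (i`!)%:R) *: iter i e p.2))).
rewrite /index_iota subn0; apply: eq_bigr => i _.
by rewrite /= -(addn0 c) (henv 0%N) //= /divpow !scalerA mulrA.
Qed.

Section Chevalley.
Context (k_closed : GRing.closed_field_axiom k) (ys : seq L).

Definition values z : seq k := [seq ev z u | u <- ys].

Lemma term_value T : GRing.rterm T -> exists l : L, forall z,
  GRing.eval (values z) T = ev z l.
Proof.
elim: T => //=.
- move=> i _; exists ys`_i => z.
  have [iy|iy] := ltnP i (size ys); first by rewrite (nth_map 0).
  by rewrite !nth_default ?ev0 ?size_map.
- by move=> c _; exists (c *: 1) => z; rewrite ev_scalar.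
- by move=> n _; exists (n%:R *: 1) => z; rewrite ev_scalar.
- move=> T1 ih1 T2 ih2 /andP[/ih1[l1 h1] /ih2[l2 h2]].
  by exists (l1 + l2) => z; rewrite h1 h2 evD.
- by move=> T1 ih1 /ih1[l1 h1]; exists (- l1) => z; rewrite h1 -mulN1r -scaleN1r evZ mulN1r.
- by move=> T1 ih1 n /ih1[l1 h1]; exists (n%:R *: l1) => z; rewrite h1 evZ mulr_natl.
- move=> T1 ih1 T2 ih2 /andP[/ih1[l1 h1] /ih2[l2 h2]].
  by exists (l1 * l2) => z; rewrite h1 h2 evM.
move=> T1 ih1 n /ih1[l1 h1]; exists (l1 ^+ n) => z; rewrite h1.
by elim: n => [|n ih]; rewrite ?expr0 ?ev1 // !exprS evM ih.
Qed.

(** Since [L] is a domain, an equation between two of its elements either always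
    holds or fails on a dense open set, and finitely many such sets meet. *)
Lemma generic_truth f : GRing.qf_form f && GRing.rformula f ->
  exists (g : L) (b : bool), g <> 0 /\
    forall z, ev z g <> 0 -> GRing.qf_eval (values z) f = b.
Proof.
have one0 : (1 : L) <> 0 by apply/eqP/oner_neq0.
have two f1 f2 (op : bool -> bool -> bool) :
    (exists (g : L) (b : bool), g <> 0 /\
      forall z, ev z g <> 0 -> GRing.qf_eval (values z) f1 = b) ->
    (exists (g : L) (b : bool), g <> 0 /\
      forall z, ev z g <> 0 -> GRing.qf_eval (values z) f2 = b) ->
    exists (g : L) (b : bool), g <> 0 /\ forall z, ev z g <> 0 ->
      op (GRing.qf_eval (values z) f1) (GRing.qf_eval (values z) f2) = b.
  move=> [g1 [b1 [g10 h1]]] [g2 [b2 [g20 h2]]]; exists (g1 * g2), (op b1 b2).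
  split=> [/L_domain[]//|z]; rewrite evM => /eqP; rewrite mulf_eq0 negb_or.
  by move=> /andP[/eqP z1 /eqP z2]; rewrite h1 // h2.
elim: f => //=.
- by move=> b _; exists 1, b.
- move=> T1 T2 /andP[/term_value[l1 h1] /term_value[l2 h2]].
  have [l12|l12] := pselect (l1 = l2).
    by exists 1, true; split=> // z _; rewrite h1 h2 l12 eqxx.
  exists (l1 - l2), false; split=> [/subr0_eq//|z].
  by rewrite evB h1 h2 => /eqP; rewrite subr_eq0 => /negPf.
- move=> f1 ih1 f2 ih2 /andP[/andP[q1 q2] /andP[r1 r2]].
  by apply: (two f1 f2 andb); [apply: ih1; rewrite q1 | apply: ih2; rewrite q2].
- move=> f1 ih1 f2 ih2 /andP[/andP[q1 q2] /andP[r1 r2]].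
  by apply: (two f1 f2 orb); [apply: ih1; rewrite q1 | apply: ih2; rewrite q2].
- move=> f1 ih1 f2 ih2 /andP[/andP[q1 q2] /andP[r1 r2]].
  by apply: (two f1 f2 implb); [apply: ih1; rewrite q1 | apply: ih2; rewrite q2].
move=> f1 ih1 h; have [g [b [g0 hg]]] := ih1 h.
by exists g, (~~ b); split=> // z /hg ->.
Qed.

(** Chevalley's theorem for a dominant product of flows, by quantifier
    elimination over the algebraically closed field k: belonging to the image
    is expressed by a quantifier-free formula, which is generically true or
    generically false, and density of the image excludes the latter. *)
Lemma image_values (es : seq (L -> L)) x :
  (forall e, List.In e es -> LND ev e) ->
  (forall a, a <> 0 -> exists ts, size ts = size es /\ ev x (flows es ts a) <> 0) ->
  exists g : L, g <> 0 /\ forall z, ev z g <> 0 ->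
    exists ts, size ts = size es /\
      forall u, u \in ys -> ev z u = ev x (flows es ts u).
Proof.
move=> hes dom; have les e : List.In e es -> lnil e by case/hes.
set r := size ys; set n := size es.
have /choice[ps hps] := fun u => flows_terms r u les.
pose T u := foldr (fun (p : GRing.term k * L) w =>
  GRing.Add (GRing.Mul p.1 (GRing.Const (ev x p.2 : k))) w) (GRing.Const 0) (ps u).
have rT u : GRing.rterm (T u).
  by rewrite /T; elim: (ps u) (hps u).1 => //= p s ih /andP[-> /ih ->].
have evalT (env ts : seq k) u : size ts = n -> (forall i, (i < n)%N -> env`_(r + i) = ts`_i) ->
    GRing.eval env (T u) = ev x (flows es ts u).
  move=> sts henv; rewrite ((hps u).2 env ts) // (fun_sum (ev_functional x)) /T.
  elim: (ps u) => [|p s ih] /=; first by rewrite big_nil.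
  by rewrite big_cons ih evZ.
(* The variables below r stand for the values at z, the n ones from r on for
   the times. *)
pose F := foldr (fun i f => GRing.And (GRing.Equal (GRing.Var k i) (T ys`_i)) f) (GRing.Bool true) (iota 0 r).
have rF : GRing.rformula (foldr GRing.Exists F (iota r n)).
  elim: (iota r n) => //=; rewrite /F; elim: (iota 0 r) => //= i s ->.
  by rewrite rT.
have FE e : GRing.holds e F <-> forall i, (i < r)%N -> e`_i = GRing.eval e (T ys`_i).
  have -> : (forall i, (i < r)%N -> e`_i = GRing.eval e (T ys`_i)) <->
     (forall i, i \in iota 0 r -> e`_i = GRing.eval e (T ys`_i)).
    by split=> h i hi; apply: h; move: hi; rewrite mem_iota.
  rewrite /F; elim: (iota 0 r) => //= i s ih; rewrite ih; split.
    by move=> [e1 e2] l; rewrite inE => /orP[/eqP->|/e2].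
  move=> h; split; first by apply: h; rewrite mem_head.
  by move=> l ls; apply: h; rewrite inE ls orbT.
have szv z : size (values z) = r by rewrite size_map.
have nthv z i : (i < r)%N -> (values z)`_i = ev z ys`_i by move=> ir; rewrite (nth_map 0).
have inv z : GRing.holds (values z) (foldr GRing.Exists F (iota r n)) <->
    exists ts, size ts = n /\ forall u, u \in ys -> ev z u = ev x (flows es ts u).
  rewrite -GRing.foldExistsP; split=> [[e' he' /FE hF]|[ts [sts hts]]].
    exists [seq e'`_(r + i) | i <- iota 0 n]; rewrite size_map size_iota; split=> //.
    move=> y /(nthP 0)[i ir <-]; rewrite -nthv // he'; last first.
      by rewrite !inE mem_iota negb_and -ltnNge ir.
    rewrite hF // (evalT e' [seq e'`_(r + i) | i <- iota 0 n]) ?size_map ?size_iota //.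
    by move=> l ln; rewrite (nth_map 0%N) ?size_iota // nth_iota.
  exists (values z ++ ts).
    move=> i; rewrite !inE mem_iota negb_and -!leqNgt -ltnNge nth_cat szv.
    move=> /orP[->//|ni].
    have ir : (r <= i)%N by apply: leq_trans ni; apply: leq_addr.
    rewrite ltnNge ir /= !nth_default ?szv // sts; lia.
  apply/FE => i ir; rewrite nth_cat szv ir nthv // (evalT _ ts) //.
    by rewrite hts // mem_nth.
  by move=> l ln; rewrite nth_cat szv ltnNge leq_addr /= addKn.
have okQ := ClosedFieldQE.holds_ex_elim k_closed.
have wfQ := @ClosedFieldQE.wf_ex_elim k.
have qP e := GRing.quantifier_elim_rformP wfQ okQ e rF.
have [g [b [g0 hg]]] := generic_truth (GRing.quantifier_elim_wf wfQ rF).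
exists g; split=> // z zg; apply/inv/qP; rewrite hg //.
have [ts [sts hts]] := dom g g0.
have [y yE] := flows_point ts x hes.
rewrite -(hg y) ?yE //; apply/qP/inv; by exists ts.
Qed.

End Chevalley.

(** A point of [X] is determined near x by the values of finitely many elements
    of [L], so it suffices to control these values. The function v is added to
    the local coordinates in order that the two points compared lie where the
    coordinates are valid. *)
Lemma dominant_flows_open (k_closed : GRing.closed_field_axiom k)
    (es : seq (L -> L)) x :
  (forall e, List.In e es -> LND ev e) ->
  (forall a, a <> 0 -> exists ts, size ts = size es /\ ev x (flows es ts a) <> 0) ->
  exists g : L, g <> 0 /\ forall z, ev z g <> 0 ->
    exists ts, size ts = size es /\ forall a, ev z a = ev x (flows es ts a).
Proof.
move=> hes dom; have [alpha [beta [v [vx hv]]]] := local_coordinates x.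
pose ys := v :: map alpha (enum 'I_m) ++ map beta (enum 'I_m).
have [g [g0 hg]] := image_values k_closed ys hes dom.
exists (v * g); split=> [/L_domain[v0|//]|z].
  by move: vx; rewrite v0 ev0 eqxx.
rewrite evM => /eqP; rewrite mulf_eq0 negb_or => /andP[zv /eqP /hg[ts [sts hts]]].
exists ts; split=> //; have [y yE] := flows_point ts x hes.
suff -> : z = y by [].
have yz u : u \in ys -> ev y u = ev z u by move=> uy; rewrite yE hts.
have yv : ev y v != 0 by rewrite yz // mem_head.
apply/val_inj/funext => i; have [_ ->] := hv z zv i; have [_ ->] := hv y yv i.
by rewrite !yz // inE mem_cat ?(map_f alpha) ?(map_f beta) ?mem_enum ?orbT.
Qed.

(** * The second derivation *)

Section Saturated.
Context (N : set (L -> L)) (hN : forall d, N d -> LND ev d /\ d <> (fun=> 0)).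
Context (hsat : saturated ev N).

Lemma N_LND d : N d -> LND ev d.
Proof. by case/hN. Qed.

Lemma N_lnil d : N d -> lnil d.
Proof. by case/N_LND. Qed.

Lemma N_der d : N d -> derivation d.
Proof. by case/N_LND. Qed.

Lemma N_conj d t sigma : N d -> N sigma -> N (dconj d t sigma).
Proof.
move=> Nd Ns; have [g [eg gE]] := flow_automorphism t (N_LND Nd).
apply: (hsat.1 g sigma) => //; first by apply: generated_in; exists d.
move=> a b ab x; rewrite gE /dconj.
have -> : b = flow d t a by apply: hL.1 => y; rewrite ab gE.
by rewrite (flowK char0 (N_lnil Nd)).
Qed.

(** Conjugating by exp(f sigma), where f vanishes at y, fixes y and acts on
    tangent vectors v at y by the transvection v |-> v - v(f) sigma(y). *)
Lemma twist (I : Type) (y : I -> X) sigma delta f :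
  N sigma -> N delta -> sigma f = 0 -> (forall i, ev (y i) f = 0) ->
  exists2 delta', N delta' & forall i a, ev (y i) (delta' a) =
    ev (y i) (delta a) - ev (y i) (delta f) * ev (y i) (sigma a).
Proof.
move=> Ns Nd sf fy; have [f0|/eqP f0] := pselect (f = 0).
  by exists delta => // i a; rewrite f0 (der0 (N_der Nd)) ev0 mul0r subr0.
exists (dconj (replica f sigma) 1 delta).
  by apply: N_conj => //; apply: hsat.2.
move=> i a; rewrite /dconj.
have [b ->] := flow_replica_mod2 1 (delta (flow (replica f sigma) (- 1) a)) (N_lnil Ns) sf.
have [c ->] := flow_replica_mod2 (- 1) a (N_lnil Ns) sf.
have dd := N_der Nd; rewrite expr2 !evD !evM fy !mul0r !addr0.
rewrite !(derD dd) !(derM dd) (derZ dd) !evD !evM !evZ !evD !evM fy.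
by ring.
Qed.

(** Several twists with independent effects: F_l = G_l^2 (f_l - f_l(y_l)), where
    G_l vanishes at the y_i with i <> l, is a polynomial in f_l that vanishes at
    all the points, to second order except at y_l. *)
Lemma independent_twists s (y : 'I_s -> X) (sigma : 'I_s -> L -> L) (f : 'I_s -> L)
    (P : pred 'I_s) d0 :
  N d0 -> (forall l, N (sigma l)) -> (forall l, sigma l (f l) = 0) ->
  (forall l, P l -> ev (y l) (d0 (f l)) != 0) ->
  (forall i l, P l -> i != l -> ev (y i) (f l) != ev (y l) (f l)) ->
  exists d1 (c : 'I_s -> k), [/\ N d1, forall l, P l -> c l != 0 &
    forall i a, ev (y i) (d1 a) = ev (y i) (d0 a) +
      (if P i then c i * ev (y i) (sigma i a) else 0)].
Proof.
move=> Nd0 Ns sf df sep.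
pose G l := \prod_(i | i != l) (f l - ev (y i) (f l) *: 1).
pose F l := G l ^+ 2 * (f l - ev (y l) (f l) *: 1).
have sZ l c : sigma l (f l - c *: 1) = 0.
  by rewrite (derB (N_der (Ns l))) sf (ker_scalar (N_der (Ns l))) subr0.
have sG l : sigma l (G l) = 0 by apply: (ker_prod (N_der (Ns l))).
have sF l : sigma l (F l) = 0.
  by have ds := N_der (Ns l); rewrite /F expr2 !(ker_mul ds).
have fyy i l : ev (y i) (f l - ev (y i) (f l) *: 1) = 0.
  by rewrite evB ev_scalar subrr.
have Gy i l : i != l -> ev (y i) (G l) = 0.
  by move=> il; rewrite /G (bigD1 i) //= evM fyy mul0r.
have Gl l : P l -> ev (y l) (G l) != 0.
  move=> Pl; rewrite /G; elim/big_rec: _ => [|i b il bl]; first by rewrite ev1 oner_neq0.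
  by rewrite evM mulf_neq0 // evB ev_scalar subr_eq0 eq_sym sep.
have Fy i l : ev (y i) (F l) = 0.
  rewrite /F evM; have [->|il] := eqVneq i l; first by rewrite fyy mulr0.
  by rewrite expr2 evM Gy // !mul0r.
have dF d i l : N d -> ev (y i) (d (F l)) =
    if i == l then ev (y l) (G l) ^+ 2 * ev (y l) (d (f l)) else 0.
  move=> Nd; have dd := N_der Nd.
  rewrite /F; have := fyy l l; have : d (f l - ev (y l) (f l) *: 1) = d (f l).
    by rewrite (derB dd) (ker_scalar dd) subr0.
  move: (f l - _) => u du yu; rewrite expr2 !(derM dd) du !evD !evM !evD !evM.
  case: eqVneq => [->|il]; first by rewrite yu mulr0 add0r expr2.
  by rewrite Gy //; ring.
pose c l := - (ev (y l) (G l) ^+ 2 * ev (y l) (d0 (f l))).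
have H (r : seq 'I_s) : uniq r -> exists2 d1, N d1 & forall i a,
    ev (y i) (d1 a) = ev (y i) (d0 a) +
      (if i \in r then c i * ev (y i) (sigma i a) else 0).
  elim: r => [_|l r ih /= /andP[lr ur]]; first by exists d0 => // i a; rewrite addr0.
  have [d1 Nd1 hd1] := ih ur.
  have [d2 Nd2 hd2] := twist (Ns l) Nd1 (sF l) (fun i => Fy i l).
  exists d2 => // i a; rewrite hd2 dF // hd1 inE.
  case: eqVneq => [->|il] /=; last by rewrite mul0r subr0.
  by rewrite hd1 (negPf lr) !addr0 /c mulNr.
have [d1 Nd1 hd1] := H _ (filter_uniq P (enum_uniq 'I_s)).
exists d1, c; split=> // [l Pl|i a]; last by rewrite hd1 mem_filter mem_enum andbT.
by rewrite oppr_eq0 mulf_neq0 ?expf_neq0 ?Gl ?df.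
Qed.

Lemma prod_neq0 (I : finType) (c : I -> L) : (forall i, c i <> 0) -> \prod_i c i <> 0.
Proof.
move=> h; elim/big_rec: _ => [|i b _ b0]; first exact/eqP/oner_neq0.
by move=> /L_domain[/h|].
Qed.

Lemma det_row_scale s (c : 'I_s -> L) (A : 'M[L]_s) :
  \det (\matrix_(i, j) (c i * A i j)) = (\prod_i c i) * \det A.
Proof.
rewrite (_ : \matrix_(i, j) _ = diag_mx (\row_i c i) *m A).
  by rewrite det_mulmx det_diag; congr (_ * _); apply: eq_bigr => i _; rewrite mxE.
by rewrite mul_diag_mx; apply/matrixP => i j; rewrite !mxE.
Qed.

(** In a frame of maximal rank, a derivation whose kernel lies in that of d0 is
    proportional to d0 over [L]; replacing all of these by d0 only changes the
    rows of the minor by nonzero factors. *)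
Lemma adapted_frame d0 : N d0 -> exists s (sigma : 'I_s -> L -> L) (a f : 'I_s -> L),
  [/\ ~ rank_ge N s.+1, forall i, N (sigma i),
      \det (\matrix_(i, j) sigma i (a j)) <> 0 &
      forall i, sigma i (f i) = 0 /\ (sigma i = d0 \/ d0 (f i) <> 0)].
Proof.
move=> Nd0; have [s [[sigma [a [Ns D0]] nr]]] := max_rank N_der.
have /choice[F hF] : forall i, exists F : (L -> L) * L,
    [/\ N F.1, F.1 F.2 = 0, F.1 = d0 \/ d0 F.2 <> 0 &
      exists c h : L, c <> 0 /\ forall a, c * sigma i a = h * F.1 a].
  move=> i; have [[f [sf df]]|nf] := pselect (exists f, sigma i f = 0 /\ d0 f <> 0).
    exists (sigma i, f); split=> //=; first by right.
    by exists 1, 1; split; [exact/eqP/oner_neq0 | ].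
  exists (d0, 0); split=> //=; first exact: (der0 (N_der Nd0)).
    by left.
  apply: (parallel_of_ker char0 L_domain) => //; first exact: N_lnil.
  - by case: (hN (Ns i)).
  - exact: N_der.
  - by case: (hN Nd0).
  by move=> f sf; apply: contrapT => df; apply: nf; exists f.
have /choice[c hc] : forall i, exists c : L * L, c.1 <> 0 /\ forall a, c.1 * sigma i a = c.2 * (F i).1 a.
  by move=> i; have [_ _ _ [c [h hc]]] := hF i; exists (c, h).
exists s, (fun i => (F i).1), a, (fun i => (F i).2); split=> //.
- by move=> i; case: (hF i).
- move=> E; have := det_row_scale (fun i => (c i).2) (\matrix_(i, j) (F i).1 (a j)).
  rewrite E mulr0 (_ : \matrix_(i, j) _ = \matrix_(i, j) ((c i).1 * (\matrix_(i, j) sigma i (a j)) i j)).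
    by rewrite det_row_scale => /L_domain[|//]; apply: prod_neq0 => i; case: (hc i).
  by apply/matrixP => i j; rewrite !mxE (hc i).2.
by move=> i; case: (hF i).
Qed.

(** The conditions that hold outside a finite subset of k, in a form that is
    stable under finite conjunction. *)
Definition generic (v : k -> Prop) :=
  exists2 p : {poly k}, p != 0 & forall t, p.[t] != 0 -> v t.

Lemma generic_ex v : generic v -> exists t, v t.
Proof. by move=> [p /(nonroot char0)[t pt] h]; exists t; apply: h. Qed.

Lemma generic_forall (I : finType) (v : I -> k -> Prop) :
  (forall i, generic (v i)) -> generic (fun t => forall i, v i t).
Proof.
move=> h; have /choice[p hp] : forall i, exists p : {poly k}, p != 0 /\ forall t, p.[t] != 0 -> v i t.
  by move=> i; have [p p0 hp] := h i; exists p.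
exists (\prod_i p i); first by apply/prodf_neq0 => i _; case: (hp i).
move=> t; rewrite horner_prod => /prodf_neq0 ht i.
by apply: (hp i).2; apply: ht.
Qed.

Lemma generic_and v w : generic v -> generic w -> generic (fun t => v t /\ w t).
Proof.
move=> [p p0 hp] [q q0 hq]; exists (p * q); first by rewrite mulf_neq0.
by move=> t; rewrite hornerM mulf_eq0 negb_or => /andP[/hp ? /hq].
Qed.

Lemma generic_imp (b : bool) v : (b -> generic v) -> generic (fun t => b -> v t).
Proof.
case: b => h; first by have [p p0 hp] := h isT; exists p => // t /hp.
by exists 1; rewrite ?oner_neq0.
Qed.

Lemma poly_dilate (p : {poly k}) c : exists q : {poly k},
  (forall t, q.[t] = p.[t * c]) /\ forall i, q`_i = p`_i * c ^+ i.
Proof.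
exists (\poly_(i < size p) (p`_i * c ^+ i)); split=> [t|i].
  rewrite horner_poly horner_coef; apply: eq_bigr => i _.
  by rewrite exprMn; ring.
by rewrite coef_poly; case: ltnP => // h; rewrite nth_default ?mul0r.
Qed.

(** The times are t_l = t (l + 1) with a single generic t, so that every
    condition is the nonvanishing of a polynomial in one variable. The
    determinant and the (d0 f_l)(y_l), where y_l = exp(t_l d0) x, are nonzero
    at t = 0; the difference f_l(y_i) - f_l(y_l) has the linear coefficient
    (i - l) (d0 f_l)(x), which is nonzero in characteristic 0. *)
Lemma generic_times s (sigma : 'I_s -> L -> L) (a f : 'I_s -> L) (P : pred 'I_s) d0 x :
  N d0 -> (forall i, N (sigma i)) ->
  \det (\matrix_(i, j) ev x (sigma i (a j))) != 0 ->
  (forall l, P l -> ev x (d0 (f l)) != 0) ->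
  exists t : 'I_s -> k, [/\
    \det (\matrix_(i, j) ev x (dconj d0 (t i) (sigma i) (a j))) != 0,
    forall l, P l -> ev x (flow d0 (t l) (d0 (f l))) != 0 &
    forall i l, P l -> i != l ->
      ev x (flow d0 (t i) (f l)) != ev x (flow d0 (t l) (f l))].
Proof.
move=> Nd0 Ns D0 df; have hd0 := N_lnil Nd0; pose w (i : 'I_s) : k := i.+1%:R.
suff /generic_ex[t [ht1 [ht2 ht3]]] : generic (fun t =>
    \det (\matrix_(i, j) ev x (dconj d0 (t * w i) (sigma i) (a j))) != 0 /\
    ((forall l, P l -> ev x (flow d0 (t * w l) (d0 (f l))) != 0) /\
    forall p : 'I_s * 'I_s, P p.2 && (p.1 != p.2) ->
      ev x (flow d0 (t * w p.1) (f p.2)) != ev x (flow d0 (t * w p.2) (f p.2)))).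
  exists (fun i => t * w i); split=> // i l Pl il.
  by apply: (ht3 (i, l)); rewrite Pl.
apply: generic_and; last apply: generic_and.
- have /choice[q hq] : forall p : 'I_s * 'I_s, exists q : {poly k}, forall t,
      ev x (dconj d0 (t * w p.1) (sigma p.1) (a p.2)) = q.[t].
    move=> [i j] /=; have [q [qE _]] := conj_poly (ev_functional x) (a j) hd0 (N_der (Ns i)).
    by have [r [rE _]] := poly_dilate q (w i); exists r => t; rewrite rE -qE.
  have dE t : (\det (\matrix_(i, j) q (i, j))).[t] =
      \det (\matrix_(i, j) ev x (dconj d0 (t * w i) (sigma i) (a j))).
    rewrite -horner_evalE -det_map_mx; congr (\det _); apply/matrixP => i j.
    by rewrite !mxE (hq (i, j)).
  exists (\det (\matrix_(i, j) q (i, j))) => [|t]; last by rewrite dE.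
  apply: contraNneq D0 => q0; have := dE 0; rewrite q0 horner0 => ->; apply/eqP.
  congr (\det _); apply/matrixP => i j.
  by rewrite !mxE mul0r (conj_id (sigma i) hd0).
- apply: generic_forall => l; apply: generic_imp => Pl.
  have [q [qE qc]] := flow_poly (ev_functional x) (d0 (f l)) hd0.
  have [r [rE rc]] := poly_dilate q (w l).
  exists r => [|t]; last by rewrite rE -qE.
  apply: contraNneq (df l Pl) => r0; have := rE 0.
  by rewrite r0 horner0 mul0r -qE (flow_id hd0) => <-.
apply: generic_forall => -[i l] /=; apply: generic_imp => /andP[Pl il].
have [q [qE qc]] := flow_poly (ev_functional x) (f l) hd0.
have [r [rE rc]] := poly_dilate q (w i); have [r' [rE' rc']] := poly_dilate q (w l).
exists (r - r') => [|t]; last by rewrite hornerD hornerN rE rE' -!qE subr_eq0.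
apply/negP => /eqP/polyP/(_ 1%N)/eqP; rewrite coef0 coefB rc rc' !expr1 -mulrBr mulf_eq0.
rewrite qc /divpow /= -[1`!]/1%N invr1 scale1r (negPf (df l Pl)) /= subr_eq0.
apply/negP; apply: contra il => /eqP; rewrite /w.
by move=> /(natr_inj char0)[/val_inj->].
Qed.

Definition transported d0 d1 s (t : 'I_s -> k) (i : 'I_s.+1) : L -> L :=
  oapp (fun l => dconj d0 (t l) d1) d0 (unlift ord0 i).

(** For generic x and times t_l, the twists turn the value of d0 at y_l =
    exp(t_l d0) x into a nonzero multiple of d0 + c_l sigma_l, for the sigma_l
    other than d0. Transported back to x along the flow of d0, which preserves
    d0, these values and that of d0 span the same space as the transported
    frame. *)
Lemma spanning_derivation d0 : N d0 ->
  exists s (t : 'I_s -> k) d1 x, [/\ N d1, d1 <> d0 &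
    forall tau, N tau -> exists c : 'I_s.+1 -> k, forall b,
      ev x (tau b) = \sum_i c i * ev x (transported d0 d1 t i b)].
Proof.
move=> Nd0; have [s [sigma [a [f [nr Ns D0 hf]]]]] := adapted_frame Nd0.
have hd0 := N_lnil Nd0; pose P l := `[< d0 (f l) <> 0 >].
pose g l := if P l then d0 (f l) else 1.
have /ev_neq0[x /eqP] : \det (\matrix_(i, j) sigma i (a j)) * \prod_l g l <> 0.
  move=> /L_domain[//|]; apply: prod_neq0 => l.
  by rewrite /g; case: ifP => [/asboolP//|_]; apply/eqP/oner_neq0.
rewrite evM mulf_eq0 negb_or ev_det => /andP[Dx gx].
have df l : P l -> ev x (d0 (f l)) != 0.
  move=> Pl; move: gx; rewrite (bigD1 l) //= evM mulf_eq0 negb_or => /andP[+ _].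
  by rewrite /g Pl.
have {}Dx : \det (\matrix_(i, j) ev x (sigma i (a j))) != 0.
  by move: Dx; congr (\det _ != 0); apply/matrixP => i j; rewrite !mxE.
have [t [Dt dt st]] := generic_times Nd0 Ns Dx df.
have /choice[y yE] : forall l, exists z, forall b, ev z b = ev x (flow d0 (t l) b).
  by move=> l; apply: flow_point; apply: N_LND.
have [||d1 [c [Nd1 c0 d1E]]] := @independent_twists _ y sigma f P d0 Nd0 Ns (fun l => (hf l).1).
- by move=> l Pl; rewrite yE dt.
- by move=> i l Pl il; rewrite !yE st.
have conjE l d b : ev x (dconj d0 (t l) d b) = ev (y l) (d (flow d0 (- t l) b)).
  by rewrite yE.
have d0E l b : ev (y l) (d0 (flow d0 (- t l) b)) = ev x (d0 b).
  by rewrite -conjE conj_self.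
(* A factor 1 or 2 makes the new derivation differ from d0. *)
have [u u0 ud1] : exists2 u : k, u != 0 & replica (u *: 1) d1 <> d0.
  have [e|ne] := pselect (d1 = d0); last first.
    exists 1; rewrite ?oner_neq0 // => e; apply: ne; rewrite -e.
    by apply: funext => b; rewrite /replica scale1r mul1r.
  exists 2%:R; first exact: (natr_neq0 char0).
  move=> e2; case: (hN Nd0) => _; apply; apply: funext => b.
  have := congr1 (@^~ b) e2; rewrite /replica e -scalerAl mul1r scaler_nat mulr2n => h.
  by apply: (@addrI _ (d0 b)); rewrite h addr0.
exists s, t, (replica (u *: 1) d1), x; split=> //.
  apply: hsat.2 => //; first exact: (ker_scalar (N_der Nd1)).
  by rewrite scaler_eq0 negb_or u0 oner_neq0.
move=> tau Nt.
have Nst i : N (dconj d0 (t i) (sigma i)) by apply: N_conj.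
have [C hC] := tangent_span nr Nst Dt Nt.
(* With e_l the transported conjugate, sigma_l is (e_l / u - d0) / c_l at x if
   P l holds, and sigma_l = d0 otherwise. *)
pose w l := if P l then C l / c l else 0.
pose w0 := \sum_l (if P l then - w l else C l).
exists (fun i => oapp (fun l => w l / u) w0 (unlift ord0 i)) => b.
rewrite hC big_ord_recl /transported unlift_none /= /w0 mulr_suml -big_split /=.
apply: eq_bigr => l _; rewrite liftK /= !conjE /replica -scalerAl mul1r evZ d1E d0E.
rewrite /w; have [Pl|Pl] := boolP (P l); first by field; rewrite u0 c0.
have [_ [->|/asboolP]] := hf l; last by rewrite -/(P l) (negPf Pl).
by rewrite d0E !mul0r addr0.
Qed.

Definition realized (H : set (X -> X)) (gamma : L -> L) :=
  exists2 h, H h & forall z a, ev (h z) a = ev z (gamma a).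

Lemma realized_comp S gamma gamma' :
  realized (generated S) gamma -> realized (generated S) gamma' ->
  realized (generated S) (gamma \o gamma').
Proof.
move=> [h Hh hE] [h' Hh' hE']; exists (h' \o h); first exact: generated_comp.
by move=> z a; rewrite /= hE' hE.
Qed.

Lemma realized_flows S es ts :
  (forall e t, List.In e es -> realized (generated S) (flow e t)) ->
  realized (generated S) (flows es ts).
Proof.
elim: es ts => [|e es ih] ts hes.
  by exists id; [exact: generated_id | ].
case: ts => [|t ts]; first by exists id; [exact: generated_id | ].
apply: realized_comp; first by apply: hes; left.
by apply: ih => e' t' he'; apply: hes; right.
Qed.

Lemma replica_group_flows d0 d1 d t : N d0 -> N d1 -> d = d0 \/ d = d1 ->
  realized (replica_group ev d0 d1) (flow d t).
Proof.
move=> N0 N1 hd; have Nd : N d by case: hd => ->.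
have [g [eg gE]] := flow_automorphism t (N_LND Nd).
exists g => //; apply: generated_in; exists d => //; exists 1.
have r1 e : e = replica 1 e by apply: funext => b; rewrite /replica mul1r.
by case: hd => ->; [left | right]; split=> //; apply: der1; apply: N_der.
Qed.

End Saturated.
End Embedded.

Theorem proposition1p14
  (k : closedFieldType) (hchar : [pchar k] =i pred0)
  (m n : nat) (hn : (2 <= n)%N)
  (X : set (affine_space k m)) (hX : quasi_affine_variety X)
  (hdim : has_dim X n)
  (L : comAlgType k) (ev : X -> {lrmorphism L -> k^o})
  (hL : algebra_of_regular_functions ev)
  (hemb : open_embedding ev)
  (N : set (L -> L))
  (hN : forall d, N d -> LND ev d /\ d <> (fun=> 0))
  (hsat : saturated ev N)
  (htrans : transitive_on (group_of ev N))
  (d0 : L -> L) (hd0 : N d0) :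
  exists d1 : L -> L,
    [/\ N d1, d1 <> d0 & acts_with_open_orbit (replica_group ev d0 d1)].
Proof.
have Nl d : N d -> lnil d by move=> /hN[[]].
have [s [t [d1 [x [Nd1 d10 span]]]]] :=
  spanning_derivation hchar hX hL hemb hN hsat hd0.
exists d1; split=> //; exists x.
have Nconj d u sigma := N_conj hchar hL hemb hN hsat u (d := d) (sigma := sigma).
have Ne i : N (transported d0 d1 t i).
  by rewrite /transported; case: (unlift _ i) => //= l; apply: Nconj.
pose e i := to_N (Ne i); pose es := [seq \val (e i) | i <- enum 'I_s.+1].
have esP d : List.In d es -> exists i, d = transported d0 d1 t i.
  by rewrite /es; elim: (enum 'I_s.+1) => //= i r ih [<-|/ih //]; exists i.
have sz : size es = s.+1 by rewrite size_map size_enum_ord.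
have dom a : a <> 0 -> exists ts, size ts = size es /\ ev x (flows es ts a) <> 0.
  move=> a0; rewrite sz; apply: (flows_injective hchar Nl Nconj (ev_functional ev x)).
    by move=> w; apply: (span (\val w)); apply: letter_in.
  exact: (transitive_word hchar hL x Nl htrans a0).
have esL d : List.In d es -> LND ev d.
  by move=> /esP[i ->]; case: (hN (transported d0 d1 t i) (Ne i)).
have [g [g0 hg]] := dominant_flows_open hchar hX hL hemb (@GRing.solve_monicpoly k) esL dom.
apply: (@open_orbit _ _ _ _ x [set z | ev z g != 0]).
- by move=> h [d _ []].
- exact: (ev_open hL g).
- by have [z /eqP] := ev_neq0 hL g0; exists z.
move=> z /= /eqP/hg[ts [_ zE]].
have [h Hh hE] : realized ev (replica_group ev d0 d1) (flows es ts).
  apply: realized_flows => d u /esP[i ->]; rewrite /transported.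
  have real := replica_group_flows hchar hL hemb hN (d0 := d0) (d1 := d1).
  case: (unlift _ i) => [l|] /=; last by apply: real => //; left.
  have -> : flow (dconj d0 (t l) d1) u = flow d0 (t l) \o (flow d1 u \o flow d0 (- t l)).
    by apply: funext => a; rewrite (flow_conj hchar) //; apply: Nl.
  apply: realized_comp; first by apply: real => //; left.
  by apply: realized_comp; apply: real => //; [right | left].
by exists h => //; apply: (ev_inj hemb) => a; rewrite hE zE.
Qed.
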